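(* Let $G_m$ be a bounded Vilenkin group. a) There exists an absolute constant $c$ (the sequence $m$ being fixed; $c$ does not depend on $f$) such that for every $f\in H_{1/2}$ $$\sup_{n\ge2}\frac{1}{n\log n}\sum_{k=1}^{n}\|\sigma_kf\|_{1/2}^{1/2}\le c\,\|f\|_{H_{1/2}}^{1/2}.$$ b) Let $\varphi:\mathbb{N}_+\to[1,\infty)$, $n\mapsto\varphi_n$, be a nondecreasing function satisfying $$\limsup_{n\to\infty}\frac{\log n}{\varphi_n}=+\infty .$$ Then there exists $f\in H_{1/2}$ such that $$\sup_{n\in\mathbb{N}_+}\frac{1}{n\varphi_n}\sum_{k=1}^{n}\|\sigma_kf\|_{H_{1/2}}^{1/2}=\infty .$$
   Context: Let $m=(m_0,m_1,\ldots)$ be a fixed sequence of integers $m_k\ge 2$ with $\sup_k m_k<\infty$. $G_m=\prod_{k\ge0}Z_{m_k}$, $Z_{m_k}=\{0,\ldots,m_k-1\}$ the integers mod $m_k$, is the bounded Vilenkin group with product (of discrete) topology and normalized Haar measure $\mu$. $I_0(x)=G_m$, $I_n(x)=\{y\in G_m: y_0=x_0,\ldots,y_{n-1}=x_{n-1}\}$. $M_0=1$, $M_{k+1}=m_kM_k$; every $n\in\mathbb{N}$ is uniquely $n=\sum_j n_jM_j$ with $n_j\in Z_{m_j}$. $r_k(x)=\exp(2\pi i x_k/m_k)$ and $\psi_n=\prod_k r_k^{n_k}$ (Vilenkin system). $\mathbb{N}_+=\{1,2,\ldots\}$, $\mathbb{N}=\mathbb{N}_+\cup\{0\}$. For $f\in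 L_1(G_m)$: $\widehat f(n)=\int_{G_m} f\overline{\psi_n}\,d\mu$; $S_0f=0$, $S_nf=\sum_{k=0}^{n-1}\widehat f(k)\psi_k$. $\|g\|_p=(\int_{G_m}|g|^pd\mu)^{1/p}$ (quasi-norm for $p<1$). Let $\mathcal F_n$ be the $\sigma$-algebra generated by the sets $I_n(x)$, $x\in G_m$. A martingale is a sequence $f=(f^{(n)}:n\in\mathbb{N})$ of integrable functions with $f^{(n)}$ $\mathcal F_n$-measurable and $S_{M_n}f^{(l)}=f^{(n)}$ for $n\le l$. $f^*=\sup_n|f^{(n)}|$; $H_p$ ($0<p<\infty$) is the space of martingales with $\|f\|_{H_p}:=\|f^*\|_p<\infty$. For a martingale, $\widehat f(i)=\lim_{k\to\infty}\int_{G_m}f^{(k)}\overline{\psi_i}\,d\mu$ and $S_nf=\sum_{k=0}^{n-1}\widehat f(k)\psi_k$. An integrable function $g$ is identified with the martingale $(S_{M_n}g:n\in\mathbb{N})$, which defines $\|g\|_{H_p}$. Fejér means: $\sigma_nf=\frac1n\sum_{k=1}^{n}S_kf$. *)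

(* Defs.v *)
From HB Require Import structures.
From mathcomp Require Import all_boot all_order all_algebra.
From mathcomp Require Import complex.
From mathcomp Require Import all_classical all_reals all_analysis.

Set Implicit Arguments.
Unset Strict Implicit.
Unset Printing Implicit Defensive.

Import Order.TTheory GRing.Theory Num.Theory.
Import numFieldNormedType.Exports.

Local Open Scope classical_set_scope.
Local Open Scope ring_scope.
Local Open Scope complex_scope.

Definition bounded_sequence (m : nat -> nat) : Prop :=
  (forall k, (2 <= m k)%N) /\ exists B : nat, forall k, (m k <= B)%N.

(* 'Z_n is the ring of integers modulo n only for n >= 2, which
   [bounded_sequence m] guarantees for all n = m k. *)
Definition vilenkin (m : nat -> nat) : Type :=
  prod_topology (fun k : nat => discrete_topology 'Z_(m k)).

HB.instance Definition _ m := Topological.on (vilenkin m).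
HB.instance Definition _ m := isPointed.Build (vilenkin m) (fun=> 0).

(* The measurable sets are the Borel sets of the product topology. *)
HB.instance Definition _ m :=
  Measurable.copy (vilenkin m) (g_sigma_algebraType (@open (vilenkin m))).

Section group.
Variable m : nat -> nat.
Implicit Types x y : vilenkin m.

Definition vcoord x (k : nat) : 'Z_(m k) := x k.

Definition vadd x y : vilenkin m := fun k => vcoord x k + vcoord y k.

Definition cylinder (n : nat) x : set (vilenkin m) :=
  [set y | forall k, (k < n)%N -> vcoord y k = vcoord x k].

Definition cylinders (n : nat) : set (set (vilenkin m)) := range (cylinder n).

(* The group is compact and metrizable, so a Borel probability measure on it
   is automatically Radon. *)
Definition normalized_haar (R : realType) (mu : probability (vilenkin m) R) :
  Prop := forall x (A : set (vilenkin m)),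
    measurable A -> mu [set vadd x y | y in A] = mu A.

Definition vprod (k : nat) : nat := (\prod_(j < k) m j)%N.

(* The digit n_j in the expansion n = \sum_j n_j M_j with n_j < m j and
   M_j = vprod j. *)
Definition vdigit (n j : nat) : nat := ((n %/ vprod j) %% m j)%N.

Variable R : realType.

Definition expi (t : R) : R[i] := cos t +i* sin t.

Definition rademacher (k : nat) x : R[i] :=
  expi (2 * pi * (vcoord x k : nat)%:R / (m k)%:R).

(* Since M_k >= 2 ^ k > k, the digits n_k with k >= n all vanish, so that the
   product over all k reduces to the product over k < n. *)
Definition vchar (n : nat) x : R[i] :=
  \prod_(k < n) rademacher k x ^+ vdigit n k.

End group.

Section martingales.
Variables (m : nat -> nat) (R : realType) (mu : probability (vilenkin m) R).
Implicit Types (g : vilenkin m -> R[i]) (f : nat -> vilenkin m -> R[i]).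

Definition cintegrable g : Prop :=
  mu.-integrable setT (fun x => (complex.Re (g x))%:E) /\
  mu.-integrable setT (fun x => (complex.Im (g x))%:E).

Definition cintegral g : R[i] :=
  Rintegral mu setT (fun x => complex.Re (g x)) +i*
  Rintegral mu setT (fun x => complex.Im (g x)).

Definition fourier g (n : nat) : R[i] :=
  cintegral (fun x => g x * (vchar R n x)^*).

(* The partial sums and the Fejer means depend on a function or a martingale
   only through its sequence [c] of Fourier coefficients. *)
Definition partial_sum (c : nat -> R[i]) (n : nat) (x : vilenkin m) : R[i] :=
  \sum_(0 <= k < n) c k * vchar R k x.

Definition fejer (c : nat -> R[i]) (n : nat) (x : vilenkin m) : R[i] :=
  n%:R^-1 * \sum_(1 <= k < n.+1) partial_sum c k x.

Definition Fmeasurable (n : nat) g : Prop :=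
  measurable_fun (setT : set (g_sigma_algebraType (@cylinders m n)))
    (fun x => complex.Re (g x)) /\
  measurable_fun (setT : set (g_sigma_algebraType (@cylinders m n)))
    (fun x => complex.Im (g x)).

Definition martingale f : Prop :=
  [/\ forall n, cintegrable (f n),
      forall n, Fmeasurable n (f n) &
      forall n l, (n <= l)%N ->
        partial_sum (fourier (f l)) (vprod m n) = f n].

(* R[i]^o is R[i] with the topology of its norm. *)
Definition mfourier f (i : nat) : R[i] :=
  limn (fun k => fourier (f k) i : R[i]^o).

Definition of_function g (n : nat) : vilenkin m -> R[i] :=
  partial_sum (fourier g) (vprod m n).

Definition cLnorm (p : R) g : \bar R :=
  Lnorm mu p%:E (fun x => (Normc.normc (g x))%:E).

Definition maximal f (x : vilenkin m) : \bar R :=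
  ereal_sup (range (fun n => (Normc.normc (f n x))%:E)).

Definition Hnorm (p : R) f : \bar R := Lnorm mu p%:E (maximal f).

Definition hardy (p : R) f : Prop := martingale f /\ (Hnorm p f < +oo)%E.

End martingales.

(* Main.v *)
Require Import Defs.
From HB Require Import structures.
From mathcomp Require Import all_boot all_order all_algebra.
From mathcomp Require Import complex.
From mathcomp Require Import all_classical all_reals all_analysis.
From mathcomp Require Import measurable_realfun.
From mathcomp Require Import ring lra zify.

(** Only the martingale at one level is needed, not an atomic decomposition.
    For M_l <= k < M_{l+1}, sigma_k f is the convolution of f^{(l+1)} with the
    Fejer kernel K_k, and convolution of functions of the first n coordinates
    satisfies ||F * K||_{1/2}^{1/2} <= M_n^{1/2} ||F||_{1/2}^{1/2}
    ||K||_{1/2}^{1/2}, by subadditivity of the square root.  The block recursion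
    of the sums k K_k gives || k K_k ||_{1/2}^{1/2} <= C (l + 1), the factors
    M_{l+1}^{1/2} and k^{-1/2} cancel, and so
    ||sigma_k f||_{1/2}^{1/2} <= C log k ||f||_{H_{1/2}}^{1/2}.

    This is sharp on average: where x_l and x_{l+1} are nonzero and the earlier
    coordinates vanish, the sum of |i K_i(x)|^{1/2} over i < M_n is at least
    c M_n M_l, and each level l < n - 1 contributes c M_n to its integral.  The
    series with terms 4^{-k-1} M_N (D_{M_{N+1}} - D_{M_N}), N = N_k, therefore
    diverges in the required sense for sparse N_k: for M_N <= n < 2 M_N, its n-th
    Fejer mean is a multiple of r_N (n - M_N) K_{n - M_N} plus a term that is
    bounded in terms of N_{k-1} only. *)
Set Implicit Arguments.
Unset Strict Implicit.
Unset Printing Implicit Defensive.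

Import Order.TTheory GRing.Theory Num.Theory.
Import numFieldNormedType.Exports.

Local Open Scope classical_set_scope.
Local Open Scope ring_scope.

Lemma sum_blocks (V : nmodType) (s q : nat) (F : nat -> V) :
  \sum_(a < s * q) F a = \sum_(t < s) \sum_(a < q) F (t * q + a)%N.
Proof.
elim: s => [|s IH]; first by rewrite mul0n !big_ord0.
rewrite big_ord_recr /= -IH mulSn addnC.
rewrite -(big_mkord xpredT F) (big_cat_nat (n := (s * q)%N)) ?leq_addr //=.
congr (_ + _); first by rewrite big_mkord.
rewrite -{1}[(s * q)%N]add0n big_addn addKn big_mkord.
by apply: eq_bigr => i _; rewrite addnC.
Qed.

Lemma sum_ord_addn (V : nmodType) (a b : nat) (F : nat -> V) :
  \sum_(i < a + b) F i = \sum_(i < a) F i + \sum_(i < b) F (a + i)%N.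
Proof. by rewrite big_split_ord. Qed.

(** * Digits, cylinders and characters *)

Section digits.
Variable m : nat -> nat.
Hypothesis m_ge2 : forall k, (2 <= m k)%N.
Local Notation M := (vprod m).
Implicit Types x y z : vilenkin m.

Lemma vprod0 : M 0 = 1%N. Proof. by rewrite /vprod big_ord0. Qed.

Lemma vprodS n : M n.+1 = (m n * M n)%N.
Proof. by rewrite /vprod big_ord_recr /= mulnC. Qed.

Lemma vprod_gt0 n : (0 < M n)%N.
Proof.
elim: n => [|n IH]; first by rewrite vprod0.
by rewrite vprodS muln_gt0 IH andbT (leq_trans _ (m_ge2 n)).
Qed.

Lemma expn2_vprod n : (2 ^ n <= M n)%N.
Proof.
elim: n => [|n IH]; first by rewrite vprod0.
by rewrite vprodS expnS leq_mul.
Qed.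

Lemma ltn_vprod n : (n < M n)%N.
Proof. exact: leq_trans (ltn_expl n (leqnn 2)) (expn2_vprod n). Qed.

Lemma dvdn_vprod k n : (k <= n)%N -> (M k %| M n)%N.
Proof.
move=> /subnK <-; elim: (n - k)%N => [|j IH] //.
by rewrite addSn vprodS dvdn_mull.
Qed.

Lemma leq_vprod k n : (k <= n)%N -> (M k <= M n)%N.
Proof. by move=> kn; apply: dvdn_leq; [exact: vprod_gt0|exact: dvdn_vprod]. Qed.

Lemma exists_level k : (0 < k)%N -> exists l, (M l <= k < M l.+1)%N.
Proof.
move=> k0; have e0 : exists l, (M l <= k)%N by exists 0%N; rewrite vprod0.
have bd l : (M l <= k)%N -> (l <= k)%N.
  by move=> /(leq_trans (ltn_vprod l)) /ltnW.
case: (ex_maxnP e0 bd) => l lk lmax; exists l; rewrite lk /= ltnNge.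
by apply/negP => /lmax; rewrite ltnn.
Qed.

Lemma vdigit_low n k s i : (k < n)%N -> vdigit m (s * M n + i) k = vdigit m i k.
Proof.
move=> kn; rewrite /vdigit.
have /dvdnP [q Eq] : (M k.+1 %| M n)%N by exact: dvdn_vprod.
rewrite Eq vprodS !mulnA divnMDl ?vprod_gt0 //.
by rewrite modnMDl.
Qed.

Lemma vdigit_top n s i : (i < M n)%N -> (s < m n)%N ->
  vdigit m (s * M n + i) n = s.
Proof.
by move=> iM sm; rewrite /vdigit divnMDl ?vprod_gt0 // divn_small // addn0 modn_small.
Qed.

Lemma vdigit_high n k i : (i < M n)%N -> (n <= k)%N -> vdigit m i k = 0%N.
Proof.
move=> iM nk; rewrite /vdigit divn_small ?mod0n //.
exact: leq_trans iM (leq_vprod nk).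
Qed.

Definition vpoint (a : nat) : vilenkin m := fun k => inZp (a %/ M k).

Lemma vcoord_vpoint a k : vcoord (vpoint a) k = vdigit m a k :> nat.
Proof. by rewrite /vcoord /vpoint /= /vdigit; congr (_ %% _)%N; rewrite Zp_cast. Qed.

Lemma vcoord_ltn (x : vilenkin m) k : (vcoord x k < m k)%N.
Proof. by have := ltn_ord (vcoord x k); rewrite [X in (_ < X)%N]Zp_cast. Qed.

Definition vindex (n : nat) (x : vilenkin m) : nat :=
  (\sum_(k < n) vcoord x k * M k)%N.

Lemma vindexS n x : vindex n.+1 x = (vcoord x n * M n + vindex n x)%N.
Proof. by rewrite /vindex big_ord_recr /= addnC. Qed.

Lemma vindex_ltn n x : (vindex n x < M n)%N.
Proof.
elim: n => [|n IH]; first by rewrite vprod0 /vindex big_ord0.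
rewrite vindexS vprodS; have := vcoord_ltn x n; have := vprod_gt0 n; nia.
Qed.

Lemma vdigit_vindex n x k : (k < n)%N -> vdigit m (vindex n x) k = vcoord x k.
Proof.
elim: n => // n IH; rewrite ltnS leq_eqVlt vindexS => /orP[/eqP ->|kn].
  by rewrite vdigit_top ?vindex_ltn ?vcoord_ltn.
by rewrite vdigit_low // IH.
Qed.

Lemma cylinder_vindex n x : cylinder n x (vpoint (vindex n x)).
Proof.
by move=> k kn; apply: ord_inj; rewrite vcoord_vpoint vdigit_vindex.
Qed.

Lemma cylinder_sym n x y : cylinder n x y -> cylinder n y x.
Proof. by move=> xy k kn; rewrite xy. Qed.

Lemma cylinder_trans n x y z : cylinder n x y -> cylinder n y z -> cylinder n x z.
Proof. by move=> xy yz k kn; rewrite yz ?xy. Qed.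

Lemma cylinderW k n x y : (k <= n)%N -> cylinder n x y -> cylinder k x y.
Proof. by move=> kn xy j jk; apply: xy; exact: leq_trans jk kn. Qed.

Lemma eq_vdigits n a b : (a < M n)%N -> (b < M n)%N ->
  (forall k, (k < n)%N -> vdigit m a k = vdigit m b k) -> a = b.
Proof.
elim: n a b => [|n IH] a b; first by rewrite vprod0; case: a; case: b.
move=> aM bM ab; have Mn0 := vprod_gt0 n.
have dd c : (c < M n.+1)%N -> (c %/ M n = vdigit m c n)%N.
  by move=> cM; rewrite /vdigit modn_small // ltn_divLR // -vprodS.
rewrite (divn_eq a (M n)) (divn_eq b (M n)) !dd // ab //; congr (_ + _)%N.
apply: IH; rewrite ?ltn_mod // => k kn.
rewrite -(vdigit_low (a %/ M n) (a %% M n) kn) -divn_eq.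
by rewrite -(vdigit_low (b %/ M n) (b %% M n) kn) -divn_eq ab // ltnW.
Qed.

Lemma vpoint_inj n a b : (a < M n)%N -> (b < M n)%N ->
  cylinder n (vpoint a) (vpoint b) -> a = b.
Proof.
move=> aM bM ab; apply: (eq_vdigits aM bM) => k kn.
by rewrite -!vcoord_vpoint ab.
Qed.

Lemma vcoord_vpoint_low n k s a : (k < n)%N ->
  vcoord (vpoint (s * M n + a)) k = vcoord (vpoint a) k.
Proof. by move=> kn; apply: ord_inj; rewrite !vcoord_vpoint vdigit_low. Qed.

Definition vsub (x y : vilenkin m) : vilenkin m :=
  fun k => vcoord x k - vcoord y k.

Definition depends (T : Type) (n : nat) (g : vilenkin m -> T) :=
  forall x y, cylinder n x y -> g y = g x.

Lemma dependsW (T : Type) k n (g : vilenkin m -> T) :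
  (k <= n)%N -> depends k g -> depends n g.
Proof. by move=> kn gk x y /(cylinderW kn); exact: gk. Qed.

Lemma depends_comp (T U : Type) n (h : T -> U) (g : vilenkin m -> T) :
  depends n g -> depends n (fun x => h (g x)).
Proof. by move=> dg x y /dg ->. Qed.

Lemma depends_vpoint (T : Type) n s a (g : vilenkin m -> T) :
  depends n g -> g (vpoint (s * M n + a)) = g (vpoint a).
Proof. by move=> dg; apply: dg => k kn; exact: vcoord_vpoint_low. Qed.

Lemma sum_vsub (V : nmodType) n (g : vilenkin m -> V) y : depends n g ->
  \sum_(a < M n) g (vsub (vpoint a) y) = \sum_(a < M n) g (vpoint a).
Proof.
move=> dg; pose h (a : 'I_(M n)) := Ordinal (vindex_ltn n (vsub (vpoint a) y)).
have h_inj : injective h.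
  move=> a b /(congr1 val) /= hab; apply/val_inj/(vpoint_inj (n := n)) => //= k kn.
  have : vcoord (vsub (vpoint a) y) k = vcoord (vsub (vpoint b) y) k.
    by apply: ord_inj; rewrite -!(vdigit_vindex _ kn) hab.
  by move/addIr.
rewrite [RHS](reindex_inj h_inj) /=; apply: eq_bigr => a _.
by apply/esym/dg/cylinder_vindex.
Qed.

End digits.

Section normc.
Variable R : rcfType.
Implicit Types z w : R[i].

Lemma normc_ge0 z : 0 <= Normc.normc z.
Proof. by case: z => a b; exact: sqrtr_ge0. Qed.

Lemma ler_normcD z w : Normc.normc (z + w) <= Normc.normc z + Normc.normc w.
Proof. exact: le_normcD. Qed.

Lemma normc_opp z : Normc.normc (- z) = Normc.normc z.
Proof. exact: normcN. Qed.

Lemma normc_nat n : Normc.normc (n%:R : R[i]) = n%:R.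
Proof. by rewrite -[RHS](congr1 (fun u => u *+ n) (Normc.normc1 R)); exact: normcMn. Qed.

Lemma normcX z n : Normc.normc (z ^+ n) = Normc.normc z ^+ n.
Proof.
by elim: n => [|n IH]; rewrite ?expr0 ?Normc.normc1 // !exprS Normc.normcM IH.
Qed.

Lemma normc_sum (I : Type) (r : seq I) (P : pred I) (F : I -> R[i]) :
  Normc.normc (\sum_(i <- r | P i) F i) <= \sum_(i <- r | P i) Normc.normc (F i).
Proof.
elim/big_rec2: _ => [|i b a _ ab]; first by rewrite Normc.normc0.
by apply: le_trans (ler_normcD _ _) _; rewrite lerD2l.
Qed.

End normc.

Section expi.
Variable R : realType.
Local Open Scope complex_scope.

Lemma expi0 : expi 0 = 1 :> R[i].
Proof. by rewrite /expi cos0 sin0. Qed.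

Lemma expiD (s t : R) : expi (s + t) = expi s * expi t.
Proof.
rewrite /expi cosD sinD.
transitivity ((cos s * cos t - sin s * sin t) +i* (cos s * sin t + sin s * cos t)).
  by congr Complex; ring.
by [].
Qed.

Lemma expiMn (t : R) n : expi (t * n%:R) = expi t ^+ n.
Proof.
elim: n => [|n IH]; first by rewrite mulr0 expi0.
by rewrite -addn1 natrD mulrDr mulr1 expiD IH exprD.
Qed.

Lemma conj_expi (t : R) : expi t * (expi t)^* = 1.
Proof.
rewrite /expi; apply/eqP; rewrite eq_complex /=; have := cos2Dsin2 t.
by rewrite !expr2 mulrN opprK => ->; rewrite eqxx /= mulrN mulrC addNr.
Qed.

Lemma normc_expi (t : R) : Normc.normc (expi t) = 1.
Proof. by rewrite /expi /= cos2Dsin2 sqrtr1. Qed.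

Lemma expi_neq1 (t : R) : 0 < t < 2 * pi -> expi t != 1.
Proof.
move=> /andP[t0 t2]; apply/negP; rewrite eq_complex /= => /andP[/eqP ct _].
have : 0 < sin (t / 2).
  by apply: sin_gt0_pi; rewrite divr_gt0 //= ltr_pdivrMr // mulrC.
have := cos2Dsin2 (t / 2); have : t = (t / 2) + (t / 2) by rewrite -splitr.
move=> /(congr1 cos); rewrite cosD ct => h1 h2 h3.
nra.
Qed.

Definition unity_root (n : nat) : R[i] := expi (2 * pi / n%:R).

Lemma unity_root_prim (n : nat) : (0 < n)%N ->
  n.-primitive_root (unity_root n).
Proof.
move=> n0; have nR : 0 < n%:R :> R by rewrite ltr0n.
apply/andP; split=> //; apply/forallP => i; apply/eqP.
rewrite /unity_root unity_rootE -expiMn; case: (eqVneq i.+1 n) => [in1|in1].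
  by rewrite in1 (divfK (lt0r_neq0 nR)) /expi mulr_natl cos2pi sin2pi eqxx.
apply/negbTE/expi_neq1; rewrite ?mulr_gt0 ?invr_gt0 ?pi_gt0 //=.
rewrite -mulrA gtr_pMr ?mulr_gt0 ?pi_gt0 // mulrC ltr_pdivrMr // mul1r ltr_nat.
by rewrite ltn_neqAle in1 ltn_ord.
Qed.
End expi.

Section characters.
Variables (R : realType) (m : nat -> nat).
Hypothesis m_ge2 : forall k, (2 <= m k)%N.
Local Notation M := (vprod m).
Implicit Types x y z : vilenkin m.
Local Open Scope complex_scope.
Local Notation rad := (rademacher R).

Lemma rademacherE k x : rad k x = unity_root R (m k) ^+ vcoord x k.
Proof. by rewrite /rademacher /unity_root -expiMn mulrAC. Qed.

Let prim k : (m k).-primitive_root (unity_root R (m k)).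
Proof. by apply: unity_root_prim; apply: leq_trans (m_ge2 k). Qed.

Lemma rademacherM k x y : rad k (vsub x y) = rad k x * (rad k y)^*.
Proof.
have H : rad k (vsub x y) * rad k y = rad k x.
  rewrite !rademacherE -exprD -(prim_expr_mod (prim k)); congr (_ ^+ _).
  have -> : vcoord x k = vcoord (vsub x y) k + vcoord y k by rewrite [RHS]subrK.
  by apply/esym; congr modn; exact: Zp_cast.
have u : rad k y * (rad k y)^* = 1 by rewrite /rademacher conj_expi.
by rewrite -H -mulrA u mulr1.
Qed.

Lemma rademacher_root k x : rad k x ^+ m k = 1.
Proof. by rewrite rademacherE exprAC (prim_expr_order (prim k)) expr1n. Qed.

Lemma rademacher_neq1 k x : vcoord x k != 0 -> rad k x != 1.
Proof.
move=> x0; rewrite rademacherE (eq_prim_root_expr (prim k) _ 0) mod0n.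
by rewrite modn_small ?vcoord_ltn //; apply: contra x0 => /eqP e; apply/eqP/ord_inj.
Qed.

Lemma rademacher_eq1 k x : vcoord x k = 0 -> rad k x = 1.
Proof. by move=> x0; rewrite rademacherE x0. Qed.

Lemma normc_rademacher k x : Normc.normc (rad k x) = 1.
Proof. exact: normc_expi. Qed.

Lemma depends_rademacher n k : (k < n)%N -> depends n (rad k : vilenkin m -> _).
Proof. by move=> kn x y xy; rewrite !rademacherE xy. Qed.

Lemma vchar_widen n i x : (i < M n)%N ->
  vchar R i x = \prod_(k < n) rad k x ^+ vdigit m i k.
Proof.
move=> iM; rewrite /vchar -!(big_mkord xpredT (fun k => rad k x ^+ vdigit m i k)).
have tail a b : (a <= b)%N -> (i < M a)%N ->
    \prod_(0 <= k < b) rad k x ^+ vdigit m i k =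
    \prod_(0 <= k < a) rad k x ^+ vdigit m i k.
  move=> ab ia; rewrite (big_cat_nat (n := a)) //=.
  rewrite -[RHS]mulr1; congr (_ * _); rewrite big_nat big1 // => k /andP[ak _].
  by rewrite (vdigit_high m_ge2 ia ak).
case: (leqP i n) => [/tail ->|/ltnW /tail ->] //.
exact: ltn_vprod.
Qed.

Lemma vcharS n s i x : (s < m n)%N -> (i < M n)%N ->
  vchar R (s * M n + i) x = rad n x ^+ s * vchar R i x.
Proof.
move=> sm iM; rewrite (vchar_widen (n := n.+1)); last first.
  rewrite vprodS; nia.
rewrite big_ord_recr /= vdigit_top // mulrC (vchar_widen x iM); congr (_ * _).
by apply: eq_bigr => k _; rewrite vdigit_low.
Qed.

Lemma vchar_vsub i x y : vchar R i (vsub x y) = vchar R i x * (vchar R i y)^*.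
Proof.
rewrite /vchar rmorph_prod -big_split /=; apply: eq_bigr => k _.
by rewrite rademacherM exprMn rmorphXn.
Qed.

Lemma normc_vchar i x : Normc.normc (vchar R i x) = 1.
Proof.
rewrite /vchar (big_morph _ (@Normc.normcM R) (Normc.normc1 R)).
by rewrite big1 // => k _; rewrite normcX normc_rademacher expr1n.
Qed.

Lemma depends_vchar n i : (i < M n)%N -> depends n (vchar R i : vilenkin m -> _).
Proof.
move=> iM x y xy; rewrite !(vchar_widen _ iM); apply: eq_bigr => k _.
by rewrite (depends_rademacher (ltn_ord k) xy).
Qed.

Definition geom (k s : nat) x : R[i] := \sum_(t < s) rad k x ^+ t.

Lemma geom_full k x :
  geom k (m k) x = if vcoord x k == 0 then (m k)%:R else 0.
Proof.
rewrite /geom; case: eqP => [x0|/eqP x0].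
  rewrite rademacher_eq1 //; under eq_bigr do rewrite expr1n.
  by rewrite sumr_const card_ord.
have /eqP := subrX1 (rad k x) (m k).
rewrite rademacher_root subrr eq_sym mulf_eq0 subr_eq0.
by rewrite (negbTE (rademacher_neq1 x0)) => /eqP.
Qed.

Lemma normc_geom k s x : Normc.normc (geom k s x) <= s%:R.
Proof.
apply: le_trans (normc_sum _ _ _) _.
under eq_bigr do rewrite normcX normc_rademacher expr1n.
by rewrite sumr_const card_ord.
Qed.

Definition geom2 (k s : nat) x : R[i] := \sum_(t < s) geom k t x.

Lemma normc_geom2 k s x : Normc.normc (geom2 k s x) <= (s ^ 2)%:R.
Proof.
apply: le_trans (normc_sum _ _ _) _.
apply: le_trans (ler_sum _ (fun (t : 'I_s) _ => normc_geom k t x)) _.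
rewrite -natr_sum ler_nat.
have -> : (s ^ 2 = \sum_(t < s) s)%N by rewrite sum_nat_const card_ord mulnn.
by apply: leq_sum => t _; exact: ltnW.
Qed.

Lemma normc_geom2_full k x : vcoord x k != 0 ->
  1 <= Normc.normc (geom2 k (m k) x).
Proof.
move=> x0; have e : (1 - rad k x) * geom2 k (m k) x = (m k)%:R.
  rewrite /geom2 mulr_sumr.
  under eq_bigr => t _.
    rewrite /geom -[1 - _]opprB mulNr -subrX1 opprB; over.
  rewrite /= sumrB -/(geom k (m k) x) geom_full (negbTE x0) subr0.
  by rewrite sumr_const card_ord.
have /(congr1 (@Normc.normc R)) := e; rewrite Normc.normcM normc_nat => e2.
have n2 : Normc.normc (1 - rad k x) <= 2.
  apply: le_trans (ler_normcD _ _) _.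
  by rewrite Normc.normc1 normc_opp normc_rademacher.
have : (2%:R : R) <= (m k)%:R by rewrite ler_nat.
have n0 := normc_ge0 (geom2 k (m k) x).
rewrite -e2; nra.
Qed.

Definition dirichlet (n : nat) x : R[i] := \sum_(i < n) vchar R i x.

(* n times the Fejer kernel *)
Definition fejer_sum (n : nat) x : R[i] := \sum_(j < n) dirichlet j.+1 x.

Lemma dirichlet_block n s i x : (s < m n)%N -> (i <= M n)%N ->
  dirichlet (s * M n + i) x =
  geom n s x * dirichlet (M n) x + rad n x ^+ s * dirichlet i x.
Proof.
move=> sm iM; rewrite /dirichlet (sum_ord_addn _ _ (fun i => vchar R i x)).
rewrite (sum_blocks _ _ (fun i => vchar R i x)) /geom mulr_suml.
congr (_ + _); last first.
  rewrite mulr_sumr; apply: eq_bigr => j _; rewrite vcharS //.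
  exact: leq_trans (ltn_ord j) iM.
apply: eq_bigr => t _; rewrite mulr_sumr; apply: eq_bigr => j _.
by rewrite vcharS // (ltn_trans (ltn_ord t)).
Qed.

Lemma dirichletS n x :
  dirichlet (M n.+1) x = geom n (m n) x * dirichlet (M n) x.
Proof.
rewrite /dirichlet vprodS (sum_blocks _ _ (fun i => vchar R i x)) /geom mulr_suml.
apply: eq_bigr => t _; rewrite mulr_sumr; apply: eq_bigr => j _.
by rewrite vcharS.
Qed.

Lemma fejer_sum_part n s i x : (s < m n)%N -> (i <= M n)%N ->
  fejer_sum (s * M n + i) x = fejer_sum (s * M n) x
   + i%:R * geom n s x * dirichlet (M n) x + rad n x ^+ s * fejer_sum i x.
Proof.
move=> sm iM; rewrite /fejer_sum (sum_ord_addn _ _ (fun j => dirichlet j.+1 x)) -addrA.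
congr (_ + _).
rewrite [rad n x ^+ s * _]mulr_sumr -mulrA -[i%:R](_ : \sum_(j < i) 1 = _); last first.
  by rewrite sumr_const card_ord.
rewrite mulr_suml -big_split /=; apply: eq_bigr => j _.
by rewrite mul1r -addnS dirichlet_block // (leq_trans (ltn_ord j)).
Qed.

Lemma fejer_sum_mul n s x : (s <= m n)%N ->
  fejer_sum (s * M n) x = (M n)%:R * geom2 n s x * dirichlet (M n) x
    + geom n s x * fejer_sum (M n) x.
Proof.
elim: s => [|s IH] sm.
  by rewrite /fejer_sum /geom2 /geom !big_ord0; ring.
rewrite mulSn addnC fejer_sum_part // IH ?(ltnW sm) //.
rewrite [geom2 n s.+1 x]/geom2 big_ord_recr -/(geom2 n s x).
rewrite [in RHS]/geom big_ord_recr -/(geom n s x) /=; ring.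
Qed.

Lemma fejer_sumS n x : fejer_sum (M n.+1) x =
  (M n)%:R * geom2 n (m n) x * dirichlet (M n) x
  + geom n (m n) x * fejer_sum (M n) x.
Proof. by rewrite vprodS fejer_sum_mul. Qed.

Lemma fejer_sum_block n s i x : (s < m n)%N -> (i <= M n)%N ->
  fejer_sum (s * M n + i) x =
  ((M n)%:R * geom2 n s x + i%:R * geom n s x) * dirichlet (M n) x
  + geom n s x * fejer_sum (M n) x + rad n x ^+ s * fejer_sum i x.
Proof.
move=> sm iM; rewrite fejer_sum_part // fejer_sum_mul ?(ltnW sm) //; ring.
Qed.

Definition near0 n x := [forall k : 'I_n, vcoord x k == 0].

Lemma near0S n x : near0 n.+1 x = near0 n x && (vcoord x n == 0).
Proof.
apply/forallP/andP => [h|[/forallP h hn] k].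
  split; last exact: (h ord_max).
  by apply/forallP => k; exact: (h (widen_ord (leqnSn n) k)).
have := ltn_ord k; rewrite ltnS leq_eqVlt => /orP[/eqP ->|kn] //.
exact: (h (Ordinal kn)).
Qed.

Lemma dirichlet_vprod n x :
  dirichlet (M n) x = if near0 n x then (M n)%:R else 0.
Proof.
elim: n => [|n IH].
  rewrite vprod0 /dirichlet big_ord1 /vchar big_ord0.
  by rewrite ifT //; apply/forallP => -[].
rewrite dirichletS IH geom_full near0S vprodS natrM.
by case: ifP => _ /=; case: ifP => _; rewrite ?mulr0 ?mul0r.
Qed.

Lemma depends_dirichlet n k : (k <= M n)%N -> depends n (dirichlet k).
Proof.
move=> kM x y xy; apply: eq_bigr => i _.
by apply: depends_vchar xy; exact: leq_trans (ltn_ord i) kM.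
Qed.

Lemma depends_fejer_sum n k : (k <= M n)%N -> depends n (fejer_sum k).
Proof.
move=> kM x y xy; apply: eq_bigr => i _.
by apply: depends_dirichlet xy; exact: leq_trans (ltn_ord i) kM.
Qed.

Lemma depends_near0 n : depends n (near0 n).
Proof. by move=> x y xy; apply: eq_forallb => k; rewrite xy. Qed.

Lemma vchar_ortho n i j : (i < M n)%N -> (j < M n)%N ->
  \sum_(a < M n) vchar R i (vpoint m a) * (vchar R j (vpoint m a))^* =
  if i == j then (M n)%:R else 0.
Proof.
elim: n i j => [|n IH] i j.
  rewrite vprod0; case: i j => // -[] // _ _.
  by rewrite big_ord1 /vchar !big_ord0 eqxx rmorph1 mulr1.
move=> iM jM; have M0 := vprod_gt0 m_ge2 n.
have si : (i %/ M n < m n)%N by rewrite ltn_divLR // -vprodS.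
have sj : (j %/ M n < m n)%N by rewrite ltn_divLR // -vprodS.
have ri := ltn_pmod i M0; have rj := ltn_pmod j M0.
rewrite (divn_eq i (M n)) (divn_eq j (M n)).
move: (i %/ M n)%N (i %% M n)%N (j %/ M n)%N (j %% M n)%N si sj ri rj.
move=> s i' t j' sm tm iM' jM'.
pose w := unity_root R (m n); pose z := w ^+ s * w^* ^+ t.
transitivity (\sum_(u < m n) z ^+ u *
   \sum_(a < M n) vchar R i' (vpoint m a) * (vchar R j' (vpoint m a))^*).
  rewrite vprodS (sum_blocks _ _ (fun a => vchar R (s * M n + i') (vpoint m a) *
    (vchar R (t * M n + j') (vpoint m a))^*)).
  apply: eq_bigr => u _; rewrite mulr_sumr.
  apply: eq_bigr => a _; rewrite !vcharS //.
  rewrite !(depends_vpoint _ _ _ (depends_vchar _)) // rademacherE.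
  rewrite vcoord_vpoint // vdigit_top // -/w /z rmorphM !rmorphXn /=.
  rewrite exprMn -!exprM ![(u * _)%N]mulnC; ring.
rewrite -mulr_suml IH //.
have ww : w * w^* = 1 by exact: conj_expi.
have -> : (s * M n + i' == t * M n + j')%N = (s == t) && (i' == j').
  apply/eqP/andP => [e|[/eqP -> /eqP ->]] //.
  have e2 := congr1 (fun q => q %% M n)%N e; rewrite !modnMDl !modn_small // in e2.
  by move: e; rewrite e2 => /addIn /eqP; rewrite eqn_pmul2r.
case: (i' == j'); rewrite ?andbF ?mulr0 // andbT; case: (eqVneq s t) => [st|st].
  have -> : z = 1 by rewrite /z st -exprMn ww expr1n.
  under eq_bigr do rewrite expr1n.
  by rewrite sumr_const card_ord vprodS natrM.
have zm : z ^+ m n = 1.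
  rewrite /z exprMn !(exprAC _ _ (m n)) -rmorphXn (prim_expr_order (prim n)).
  by rewrite rmorph1 !expr1n mulr1.
have z1 : z != 1.
  apply: contra st => /eqP z1; have : w ^+ s = w ^+ t.
    have wt : w^* ^+ t * w ^+ t = 1 by rewrite -exprMn mulrC ww expr1n.
    by rewrite -[LHS]mulr1 -wt mulrA -/z z1 mul1r.
  by move/eqP; rewrite (eq_prim_root_expr (prim n)) !modn_small.
have /eqP := subrX1 z (m n).
rewrite zm subrr eq_sym mulf_eq0 subr_eq0 (negbTE z1) /= => /eqP ->.
by rewrite mul0r.
Qed.

End characters.

Section sqrt_normc.
Variable R : realType.
Implicit Types z w : R[i].

Definition sqn z : R := Num.sqrt (Normc.normc z).

Lemma sqn_ge0 z : 0 <= sqn z. Proof. exact: sqrtr_ge0. Qed.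

Lemma sqn0 : sqn 0 = 0. Proof. by rewrite /sqn Normc.normc0 sqrtr0. Qed.

Lemma sqnM z w : sqn (z * w) = sqn z * sqn w.
Proof. by rewrite /sqn Normc.normcM sqrtrM // normc_ge0. Qed.

Lemma sqnV z : sqn z^-1 = (sqn z)^-1.
Proof. by rewrite /sqn Normc.normcV sqrtrV // normc_ge0. Qed.

Lemma sqnN z : sqn (- z) = sqn z.
Proof. by rewrite /sqn normc_opp. Qed.

Lemma sqn_nat n : sqn n%:R = Num.sqrt n%:R.
Proof. by rewrite /sqn normc_nat. Qed.

Lemma sqn_sqr_nat n : sqn (n%:R * n%:R) = n%:R.
Proof. by rewrite /sqn Normc.normcM normc_nat -expr2 sqrtr_sqr ger0_norm. Qed.

Lemma ler_sqnD z w : sqn (z + w) <= sqn z + sqn w.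
Proof.
rewrite -(@ler_pXn2r _ 2) ?nnegrE ?addr_ge0 ?sqn_ge0 //.
rewrite sqrrD !sqr_sqrtr ?normc_ge0 //.
apply: le_trans (ler_normcD _ _) _; rewrite -addrA [_ *+ 2 + _]addrC addrA.
by rewrite lerDl mulrn_wge0 // mulr_ge0 ?sqn_ge0.
Qed.

Lemma ler_sqnB z w : sqn z - sqn w <= sqn (z + w).
Proof. by rewrite lerBlDr -{1}[z](addrK w) -(sqnN w) ler_sqnD. Qed.

Lemma sqn_sum (I : Type) (r : seq I) (P : pred I) (F : I -> R[i]) :
  sqn (\sum_(i <- r | P i) F i) <= \sum_(i <- r | P i) sqn (F i).
Proof.
elim/big_rec2: _ => [|i b a _ ab]; first by rewrite sqn0.
by apply: le_trans (ler_sqnD _ _) _; rewrite lerD2l.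
Qed.

Lemma sqn_unit z : Normc.normc z = 1 -> sqn z = 1.
Proof. by rewrite /sqn => ->; rewrite sqrtr1. Qed.

Lemma ler_sqn z (r : R) : 0 <= r -> Normc.normc z <= r ^+ 2 -> sqn z <= r.
Proof. by move=> r0 zr; rewrite -[r](ger0_norm r0) -sqrtr_sqr ler_wsqrtr. Qed.

Lemma sqn_ge z (r : R) : 0 <= r -> r ^+ 2 <= Normc.normc z -> r <= sqn z.
Proof. by move=> r0 zr; rewrite -[r](ger0_norm r0) -sqrtr_sqr ler_wsqrtr. Qed.

End sqrt_normc.

(** * Averages over cylinders *)

Section averages.
Variables (R : realType) (m : nat -> nat).
Hypothesis m_ge2 : forall k, (2 <= m k)%N.
Local Notation M := (vprod m).
Implicit Types x y z : vilenkin m.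
Implicit Types g h : vilenkin m -> R.

Definition avg (n : nat) g : R := (M n)%:R^-1 * \sum_(a < M n) g (vpoint m a).

Let M0 n : 0 < (M n)%:R :> R. Proof. by rewrite ltr0n vprod_gt0. Qed.
Let m0 n : 0 < (m n)%:R :> R. Proof. by rewrite ltr0n (leq_trans _ (m_ge2 n)). Qed.

Lemma ler_avg n g h : (forall x, g x <= h x) -> avg n g <= avg n h.
Proof.
by move=> gh; rewrite ler_wpM2l ?invr_ge0 ?ler0n // ler_sum.
Qed.

Lemma eq_avg n g h : (forall x, g x = h x) -> avg n g = avg n h.
Proof. by move=> gh; congr (_ * _); apply: eq_bigr => a _. Qed.

Lemma avg_ge0 n g : (forall x, 0 <= g x) -> 0 <= avg n g.
Proof. by move=> g0; rewrite mulr_ge0 ?invr_ge0 ?ler0n // sumr_ge0. Qed.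

Lemma avgD n g h : avg n (fun x => g x + h x) = avg n g + avg n h.
Proof. by rewrite /avg big_split mulrDr. Qed.

Lemma avgZ n (c : R) g : avg n (fun x => c * g x) = c * avg n g.
Proof. by rewrite /avg -mulr_sumr mulrCA. Qed.

Lemma avg_sum n (I : Type) (r : seq I) (P : pred I) (F : I -> vilenkin m -> R) :
  avg n (fun x => \sum_(i <- r | P i) F i x) = \sum_(i <- r | P i) avg n (F i).
Proof. by rewrite /avg exchange_big mulr_sumr. Qed.

Lemma avg_tensor n (u : nat -> R) g : depends n g ->
  avg n.+1 (fun x => u (vcoord x n) * g x) =
  (m n)%:R^-1 * (\sum_(s < m n) u s) * avg n g.
Proof.
move=> dg; rewrite /avg.
transitivity ((M n.+1)%:R^-1 * (\sum_(s < m n) u s * \sum_(a < M n) g (vpoint m a))).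
  congr (_ * _); rewrite vprodS.
  rewrite (sum_blocks _ _ (fun a => u (vcoord (vpoint m a) n) * g (vpoint m a))).
  apply: eq_bigr => s _; rewrite mulr_sumr; apply: eq_bigr => a _.
  by rewrite vcoord_vpoint // vdigit_top // depends_vpoint.
by rewrite -mulr_suml vprodS natrM invfM; ring.
Qed.

Lemma avgS n g : depends n g -> avg n.+1 g = avg n g.
Proof.
move=> dg; have := avg_tensor (fun=> 1) dg.
rewrite sumr_const card_ord mulVf ?gt_eqF // mul1r => <-.
by apply: eq_avg => x; rewrite mul1r.
Qed.

Lemma avg_widen k n g : depends k g -> (k <= n)%N -> avg n g = avg k g.
Proof.
move=> dg /subnK <-; elim: (n - k)%N => [|j IH] //.
rewrite addSn avgS //; apply: dependsW dg; exact: leq_addl.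
Qed.

Lemma avg_vsub n g y : depends n g -> avg n (fun x => g (vsub x y)) = avg n g.
Proof. by move=> dg; rewrite /avg sum_vsub. Qed.

Lemma avg_coord0 n g : depends n g ->
  avg n.+1 (fun x => (vcoord x n == 0)%:R * g x) = (m n)%:R^-1 * avg n g.
Proof.
move=> dg; have := avg_tensor (fun s => (s == 0%N)%:R) dg.
rewrite (bigD1 (Ordinal (ltnW (m_ge2 n)))) //= big1 ?addr0 ?mulr1.
  by move=> <-.
by move=> [[|s]] //.
Qed.

Lemma avg_coordN0 n g : depends n g ->
  avg n.+1 (fun x => (vcoord x n != 0)%:R * g x) = (1 - (m n)%:R^-1) * avg n g.
Proof.
move=> dg; rewrite mulrBl mul1r -avg_coord0 // -(avgS dg) -mulN1r -avgZ -avgD.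
by apply: eq_avg => x; case: eqP => _ /=; ring.
Qed.

Lemma depends_near0_natr n : depends n (fun x => (near0 n x)%:R : R).
Proof.
by apply: (depends_comp (fun b : bool => b%:R)); exact: depends_near0.
Qed.

Lemma avg_near0 n : avg n (fun x => (near0 n x)%:R) = (M n)%:R^-1.
Proof.
elim: n => [|n IH].
  rewrite /avg vprod0 big_ord1 invr1 mul1r; case: (near0 0 _) /forallP => //.
  by case; case.
rewrite vprodS natrM invfM -IH -avg_coord0.
  by apply: eq_avg => x; rewrite near0S andbC; case: (_ == _); rewrite ?mul1r ?mul0r.
exact: depends_near0_natr.
Qed.

End averages.

(** * Bounds for the Fejer kernels *)

Section kernel_bounds.
Variables (R : realType) (m : nat -> nat) (B : nat).
Hypothesis m_ge2 : forall k, (2 <= m k)%N.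
Hypothesis m_leB : forall k, (m k <= B)%N.
Local Notation M := (vprod m).
Implicit Types x y z : vilenkin m.
Local Notation rad := (rademacher R).
Local Notation G := (fejer_sum R).
Local Notation D := (dirichlet R).

Let B_ge2 : (2 : R) <= B%:R.
Proof. by rewrite ler_nat; exact: leq_trans (m_ge2 0) (m_leB 0). Qed.

Let M0 n : 0 < (M n)%:R :> R. Proof. by rewrite ltr0n vprod_gt0. Qed.
Let m0 n : 0 < (m n)%:R :> R. Proof. by rewrite ltr0n (leq_trans _ (m_ge2 n)). Qed.
Let m2R n : 2 <= (m n)%:R :> R. Proof. by rewrite ler_nat. Qed.
Let mBR n : (m n)%:R <= B%:R :> R. Proof. by rewrite ler_nat. Qed.

Lemma ler_sqn_dirichlet n (c : R[i]) (r : R) x :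
  0 <= r -> Normc.normc c <= (M n)%:R * r ^+ 2 ->
  sqn (c * D (M n) x) <= (M n)%:R * r * (near0 n x)%:R.
Proof.
move=> r0 cr; rewrite dirichlet_vprod //; case: near0; last first.
  by rewrite !mulr0 sqn0.
rewrite mulr1; apply: ler_sqn; first by rewrite mulr_ge0 // ltW.
rewrite Normc.normcM normc_nat mulrC exprMn expr2 -mulrA ler_pM2l //.
Qed.

Lemma depends_sqn_fejer_sum n k : (k <= M n)%N ->
  depends n (fun x => sqn (G k x)).
Proof.
by move=> kM; apply: (depends_comp (@sqn R)); exact: depends_fejer_sum.
Qed.

(* Passing to level n + 1 multiplies the kernel by m_n where the new coordinate
   vanishes and by 0 elsewhere: the integral contracts by m_n^{-1/2} <= 3/4. *)
Lemma avg_fejer_vprod n : avg n (fun x => sqn (G (M n) x)) <= 4 * B%:R.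
Proof.
elim: n => [|n IH].
  rewrite /avg vprod0 big_ord1 invr1 mul1r /fejer_sum big_ord1.
  rewrite /dirichlet big_ord1 /vchar big_ord0.
  by rewrite sqn_unit ?Normc.normc1 //; have := B_ge2; lra.
pose u := avg n (fun x => sqn (G (M n) x)).
have u0 : 0 <= u by apply: avg_ge0 => x; exact: sqn_ge0.
apply: (@le_trans _ _ (avg n.+1 (fun x => (M n)%:R * B%:R * (near0 n x)%:R
   + Num.sqrt (m n)%:R * ((vcoord x n == 0)%:R * sqn (G (M n) x))))).
  apply: ler_avg => x; rewrite fejer_sumS //.
  apply: le_trans (ler_sqnD _ _) _; apply: lerD.
    apply: ler_sqn_dirichlet => //; rewrite Normc.normcM normc_nat ler_pM2l //.
    apply: le_trans (normc_geom2 _ _ _ _) _.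
    by rewrite -natrX ler_nat leq_exp2r.
  rewrite sqnM geom_full //; case: eqP => _.
    by rewrite sqn_nat mul1r.
  by rewrite sqn0 !mul0r mulr0.
have dn := @depends_near0_natr R m n.
have dG := depends_sqn_fejer_sum (leqnn (M n)).
rewrite avgD avgZ avgZ (avg_coord0 m_ge2 dG) -/u (avgS m_ge2 dn).
rewrite avg_near0 // mulrAC mulfV ?gt_eqF // mul1r.
pose r := Num.sqrt ((m n)%:R : R).
have r2 : r ^+ 2 = (m n)%:R by rewrite sqr_sqrtr ?ler0n.
have r0 : 0 <= r by exact: sqrtr_ge0.
have rge : 4 <= 3 * r by have := m2R n; rewrite -r2 expr2; nra.
have rpos : 0 < r by lra.
have -> : Num.sqrt (m n)%:R * ((m n)%:R^-1 * u) = r^-1 * u.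
  by rewrite -/r -r2 expr2 invfM !mulrA mulfV ?gt_eqF // mul1r.
have : r^-1 <= 3 / 4 by rewrite -div1r ler_pdivrMr //; lra.
have := IH; rewrite -/u => hu hr.
have : r^-1 * u <= 3 / 4 * (4 * B%:R) by apply: ler_pM; rewrite // ?invr_ge0.
lra.
Qed.

Lemma avg_fejer_sum n k : (k < M n)%N ->
  avg n (fun x => sqn (G k x)) <= 6 * B%:R ^+ 2 * n%:R.
Proof.
elim: n k => [|n IH] k.
  rewrite vprod0; case: k => // _; rewrite mulr0 /avg vprod0 big_ord1.
  by rewrite /fejer_sum big_ord0 sqn0 mulr0.
move=> kM; have Mn0 := vprod_gt0 m_ge2 n.
have ks : (k %/ M n < m n)%N by rewrite ltn_divLR // -vprodS.
have ki := ltn_pmod k Mn0.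
rewrite (divn_eq k (M n)); move: (k %/ M n)%N (k %% M n)%N ks ki => s i sm iM.
apply: (@le_trans _ _ (avg n.+1 (fun x => (M n)%:R * (2 * B%:R) * (near0 n x)%:R
   + B%:R * sqn (G (M n) x) + sqn (G i x)))).
  apply: ler_avg => x; rewrite fejer_sum_block //; last exact: ltnW.
  apply: le_trans (ler_sqnD _ _) _; apply: lerD; last first.
    by rewrite sqnM sqn_unit ?mul1r // normcX normc_rademacher expr1n.
  apply: le_trans (ler_sqnD _ _) _; apply: lerD; last first.
    rewrite sqnM ler_wpM2r ?sqn_ge0 //; apply: ler_sqn; first exact: ler0n.
    apply: le_trans (normc_geom _ _ _ _) _; rewrite -natrX ler_nat.
    apply: leq_trans (ltnW sm) _; apply: leq_trans (m_leB n) _.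
    by rewrite -{1}[B]expn1 leq_exp2l // (leq_trans (m_ge2 0)).
  apply: ler_sqn_dirichlet; first by rewrite mulr_ge0.
  apply: le_trans (ler_normcD _ _) _; rewrite !Normc.normcM !normc_nat.
  have sB : s%:R <= B%:R :> R by rewrite ler_nat; exact: leq_trans (ltnW sm) (m_leB n).
  have iMR : i%:R <= (M n)%:R :> R by rewrite ler_nat ltnW.
  have h1 := normc_geom2 R n s x; have h2 := normc_geom R n s x.
  have h3 : (s ^ 2)%:R <= B%:R ^+ 2 :> R by rewrite natrX lerXn2r ?nnegrE.
  have g2 := normc_ge0 (geom2 R n s x); have g1 := normc_ge0 (geom R n s x).
  apply: (@le_trans _ _ ((M n)%:R * B%:R ^+ 2 + (M n)%:R * B%:R)).
    apply: lerD; first by rewrite ler_pM2l // (le_trans h1).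
    by apply: ler_pM => //; exact: le_trans h2 sB.
  rewrite -mulrDr ler_pM2l //; have := B_ge2; rewrite expr2 exprMn !expr2; nra.
have dn := @depends_near0_natr R m n.
have dG := depends_sqn_fejer_sum (leqnn (M n)).
have di := depends_sqn_fejer_sum (ltnW iM).
rewrite avgD avgD avgZ avgZ !(avgS m_ge2 dn) (avgS m_ge2 dG) (avgS m_ge2 di).
rewrite avg_near0 // mulrAC mulfV ?gt_eqF // mul1r.
have ha := avg_fejer_vprod n; have hb := IH _ iM.
rewrite -[n.+1%:R]natr1 mulrDr mulr1; move: ha hb.
set a := avg n _; set b := avg n _ => ha hb.
have : B%:R * a <= B%:R * (4 * B%:R) by rewrite ler_wpM2l.
have := B_ge2; rewrite expr2; nra.
Qed.

Lemma avg_convolution n (F K : vilenkin m -> R[i]) : depends n K ->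
  avg n (fun x => sqn ((M n)%:R^-1 *
     \sum_(b < M n) F (vpoint m b) * K (vsub x (vpoint m b)))) <=
  Num.sqrt (M n)%:R * avg n (fun x => sqn (F x)) * avg n (fun x => sqn (K x)).
Proof.
move=> dK.
have dK' : depends n (fun x => sqn (K x)) by exact: (depends_comp (@sqn R)).
apply: (@le_trans _ _ (avg n (fun x => (Num.sqrt (M n)%:R)^-1 *
    \sum_(b < M n) sqn (F (vpoint m b)) * sqn (K (vsub x (vpoint m b)))))).
  apply: ler_avg => x; rewrite sqnM sqnV sqn_nat ler_wpM2l ?invr_ge0 ?sqrtr_ge0 //.
  apply: le_trans (sqn_sum _ _ _) _; apply: ler_sum => b _; by rewrite sqnM.
rewrite avgZ avg_sum.
under eq_bigr do rewrite avgZ (avg_vsub m_ge2 _ dK').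
rewrite -mulr_suml mulrA; apply: ler_wpM2r.
  by apply: avg_ge0 => x; exact: sqn_ge0.
rewrite /avg mulrA -{3}(@sqr_sqrtr _ (M n)%:R) ?ler0n //.
rewrite ler_wpM2r ?sumr_ge0 // => [b _|]; first exact: sqn_ge0.
by rewrite expr2 invfM mulrA mulfV ?mul1r // gt_eqF // sqrtr_gt0.
Qed.

(* Fejer sums of high order do not decay on these sets, which are disjoint for
   distinct l and have measure comparable to 1 / M_l. *)
Definition spike l x :=
  [&& near0 l x, vcoord x l != 0 & vcoord x l.+1 != 0].

Lemma sum_fejer_spike l n x : spike l x -> (l.+2 <= n)%N ->
  (M n)%:R * (M l)%:R / B%:R <= \sum_(i < M n) sqn (G i x).
Proof.
move=> /and3P[nx x0 x1]; have B0 : 0 < B%:R :> R by have := B_ge2; lra.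
have D1 : D (M l.+1) x = 0.
  by rewrite dirichlet_vprod // near0S (negbTE x0) andbF.
have F1 : (M l)%:R <= sqn (G (M l.+1) x).
  rewrite fejer_sumS // geom_full // (negbTE x0) mul0r addr0.
  rewrite dirichlet_vprod // nx; apply: sqn_ge => //.
  rewrite !Normc.normcM !normc_nat mulrAC expr2 ler_peMr //.
  exact: normc_geom2_full.
have base : (M l.+2)%:R * (M l)%:R / B%:R <= \sum_(i < M l.+2) sqn (G i x).
  rewrite (vprodS m l.+1) (sum_blocks _ _ (fun i => sqn (G i x))).
  rewrite (bigD1 (Ordinal (ltnW (m_ge2 l.+1)))) //=.
  rewrite (bigD1 (Ordinal (m_ge2 l.+1))) //= addrA -big_split /=.
  apply: ler_wpDr.
    by apply: sumr_ge0 => s _; apply: sumr_ge0 => i _; exact: sqn_ge0.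
  apply: (@le_trans _ _ (\sum_(i < M l.+1) (M l)%:R)).
    rewrite sumr_const card_ord natrM -[X in _ <= X]mulr_natl.
    rewrite ler_pdivrMr // -[X in X <= _]mulrA [X in X <= _]mulrC.
    by rewrite ler_wpM2l // mulr_ge0.
  (* The terms of index i and M_{l+1} + i differ by fejer_sum (M l.+1) x up to
     unimodular factors, so they cannot both be small. *)
  apply: ler_sum => i _; apply: le_trans F1 _.
  rewrite mul0n add0n fejer_sum_block ?(ltnW (ltn_ord i)) //.
  rewrite D1 mulr0 add0r /geom big_ord1 expr0 mul1r expr1.
  have := ler_sqnB (G (M l.+1) x) (rad l.+1 x * G i x).
  rewrite sqnM (sqn_unit (normc_rademacher _ _ _)) mul1r; lra.
have tail j : D (M (j + l.+2)) x = 0 /\ G (M (j + l.+2)) x = 0.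
  elim: j => [|j [IHD IHG]].
    rewrite add0n dirichletS // fejer_sumS // D1 !mulr0 add0r.
    by rewrite geom_full // (negbTE x1) mul0r.
  by rewrite addSn dirichletS // fejer_sumS // IHD IHG !mulr0 addr0.
move=> /subnK <-; elim: (n - l.+2)%N => [|j IH] //.
have [Dj Gj] := tail j; rewrite addSn vprodS.
rewrite (sum_blocks _ _ (fun i => sqn (G i x))).
have -> : \sum_(s < m (j + l.+2)) \sum_(i < M (j + l.+2))
    sqn (G (s * M (j + l.+2) + i) x) =
    \sum_(s < m (j + l.+2)) \sum_(i < M (j + l.+2)) sqn (G i x).
  apply: eq_bigr => s _; apply: eq_bigr => i _.
  rewrite fejer_sum_block ?(ltnW (ltn_ord i)) // Dj Gj !mulr0 !add0r.
  by rewrite sqnM sqn_unit ?mul1r // normcX normc_rademacher expr1n.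
rewrite sumr_const card_ord -[X in _ <= X]mulr_natl natrM -!mulrA ler_pM2l //.
by rewrite mulrA.
Qed.

Lemma avg_spike l n : (l.+2 <= n)%N ->
  (4 * (M l)%:R)^-1 <= avg n (fun x => (spike l x)%:R : R).
Proof.
move=> ln.
have dn := @depends_near0_natr R m l.
have dn1 : depends l.+1 (fun x => (vcoord x l != 0)%:R * (near0 l x)%:R : R).
  move=> x y xy; rewrite (dn x y (cylinderW (leqnSn l) xy)).
  by rewrite xy.
have e x : (spike l x)%:R =
    (vcoord x l.+1 != 0)%:R * ((vcoord x l != 0)%:R * (near0 l x)%:R) :> R.
  rewrite /spike; case: near0; rewrite ?mulr0 //= mulr1.
  by case: (vcoord x l != 0); rewrite ?mulr0 ?mulr1.
rewrite (eq_avg _ e) (@avg_widen _ _ _ l.+2) //; last first.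
  move=> x y xy; rewrite (dn1 x y (cylinderW (leqnSn l.+1) xy)).
  by rewrite xy.
rewrite !avg_coordN0 // avg_near0 // invfM.
have h k : 2^-1 <= 1 - (m k)%:R^-1 :> R.
  have : (m k)%:R^-1 <= 2^-1 :> R by rewrite lef_pV2 ?posrE.
  lra.
rewrite mulrA ler_pM2r ?invr_gt0 //.
have := h l; have := h l.+1; move: (1 - _) (1 - _) => a b; nra.
Qed.

Lemma sum_avg_fejer n :
  (M n)%:R * (n%:R - 1) / (4 * B%:R) <=
  \sum_(i < M n) avg n (fun x => sqn (G i x)).
Proof.
have B0 : 0 < B%:R :> R by have := B_ge2; lra.
rewrite -avg_sum.
apply: (@le_trans _ _ (avg n (fun x => \sum_(l < n.-1)
   (M n)%:R * (M l)%:R / B%:R * (spike l x)%:R))); last first.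
  apply: ler_avg => x.
  case: (pickP (fun l : 'I_n.-1 => spike l x)) => [l sl|nosp]; last first.
    rewrite big1 => [|l _]; last by rewrite nosp mulr0.
    by apply: sumr_ge0 => i _; exact: sqn_ge0.
  rewrite (bigD1 l) //= big1 ?addr0 => [|l' ll'].
    rewrite sl mulr1 sum_fejer_spike //.
    by have := ltn_ord l; lia.
  case sl' : (spike l' x); rewrite ?mulr0 //.
  case/and3P: sl => /forallP nl lx _; case/and3P: sl' => /forallP nl' lx' _.
  case: (ltngtP l l') => h.
  - by have := nl' (Ordinal h); rewrite /= (negbTE lx).
  - by have := nl (Ordinal h); rewrite /= (negbTE lx').
  - by move: ll'; rewrite -val_eqE /= h eqxx.
rewrite avg_sum; apply: (@le_trans _ _ (\sum_(l < n.-1) (M n)%:R / (4 * B%:R))).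
  rewrite sumr_const card_ord -[X in _ <= X]mulr_natr -!mulrA ler_pM2l //.
  rewrite mulrC ler_pM2l ?invr_gt0 ?mulr_gt0 //.
  by case: n => [|n] /=; [lra | rewrite -natr1; lra].
apply: ler_sum => l _; rewrite avgZ.
have ln : (l.+2 <= n)%N by have := ltn_ord l; lia.
apply: le_trans (ler_wpM2l _ (avg_spike ln)); last first.
  by rewrite mulr_ge0 ?invr_ge0 ?mulr_ge0 // ltW.
rewrite !invfM.
rewrite [X in _ <= X](_ : _ = (M n)%:R * (4^-1 / B%:R) * ((M l)%:R / (M l)%:R)).
  by rewrite mulfV ?gt_eqF ?mulr1.
by ring.
Qed.

End kernel_bounds.

(** * Integrals, Fourier coefficients and Hardy norms *)

Section cylinders.
Variable m : nat -> nat.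
Hypothesis m_ge2 : forall k, (2 <= m k)%N.
Local Notation M := (vprod m).
Implicit Types x y z : vilenkin m.

Lemma open_cylinder n x : open (cylinder n x).
Proof.
elim: n => [|n IH].
  rewrite (_ : cylinder 0 x = setT); first exact: openT.
  by apply/seteqP; split.
rewrite (_ : cylinder n.+1 x = cylinder n x `&`
    (@proj _ (fun k => discrete_topology 'Z_(m k)) n) @^-1` [set vcoord x n]).
  apply: openI => //; apply: (continuousP _).1; first exact: proj_continuous.
  exact: discrete_open.
apply/seteqP; split => [y xy|y [xy yn] k].
  by split; [exact: cylinderW xy|exact: xy].
by rewrite ltnS leq_eqVlt => /orP[/eqP ->|/xy //]; exact: yn.
Qed.

Lemma measurable_cylinder n x : measurable (cylinder n x).
Proof. by apply: sub_sigma_algebra; exact: open_cylinder. Qed.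

Lemma preimage_depends (T : Type) n (g : vilenkin m -> T) (Y : set T) :
  depends n g ->
  g @^-1` Y = \bigcup_(a in [set a | Y (g (vpoint m a))]) cylinder n (vpoint m a).
Proof.
move=> dg; apply/seteqP; split => [x Yx|x [a Ya ax]] /=.
  exists (vindex n x); last exact/cylinder_sym/cylinder_vindex.
  by rewrite /= (dg x) //; exact: cylinder_vindex.
by rewrite (dg _ _ ax).
Qed.

Lemma measurable_depends d (T : measurableType d) n (g : vilenkin m -> T) :
  depends n g -> measurable_fun setT g.
Proof.
move=> dg _ Y mY; rewrite setTI (preimage_depends _ dg).
by apply: bigcup_measurable => a _; exact: measurable_cylinder.
Qed.

Lemma measurable_depends_cylinders d (T : measurableType d) n
    (g : vilenkin m -> T) : depends n g ->
  measurable_fun (setT : set (g_sigma_algebraType (@cylinders m n))) g.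
Proof.
move=> dg _ Y mY; rewrite setTI (preimage_depends _ dg).
by apply: bigcup_measurable => a _; apply: sub_sigma_algebra; exists (vpoint m a).
Qed.

End cylinders.

Section integrals.
Variables (R : realType) (m : nat -> nat).
Hypothesis m_ge2 : forall k, (2 <= m k)%N.
Variable mu : probability (vilenkin m) R.
Hypothesis mu_haar : normalized_haar mu.
Local Notation M := (vprod m).
Implicit Types x y z : vilenkin m.

Let M0 n : 0 < (M n)%:R :> R. Proof. by rewrite ltr0n vprod_gt0. Qed.

Lemma cylinder_partition n x :
  \sum_(a < M n) \1_(cylinder n (vpoint m a)) x = 1 :> R.
Proof.
rewrite (bigD1 (Ordinal (vindex_ltn m_ge2 n x))) //= big1 ?addr0.
  by rewrite indicE mem_set //; exact/cylinder_sym/cylinder_vindex.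
move=> a an; rewrite indicE memNset // => ax; move: an; rewrite -val_eqE /= => /eqP.
apply; apply: (vpoint_inj m_ge2 (n := n)) => //; first exact: vindex_ltn.
by apply: cylinder_trans ax _; exact: cylinder_vindex.
Qed.

Lemma mu_cylinder_translate n x y : mu (cylinder n x) = mu (cylinder n y).
Proof.
have h z : mu (cylinder n z) = mu (cylinder n (fun=> 0)).
  rewrite -(mu_haar z (measurable_cylinder n (fun=> 0))); congr (mu _).
  apply/seteqP; split => [w zw|_ [w w0 <-] k kn].
    exists (vsub w z).
      by move=> k kn; rewrite /vsub {1}/vcoord zw // subrr.
    by apply: functional_extensionality_dep => k; rewrite /vadd /vsub /vcoord addrC subrK.
  by rewrite /vadd {1}/vcoord w0 // addr0.
by rewrite !h.
Qed.

Lemma mu_cylinder n x : mu (cylinder n x) = ((M n)%:R^-1)%:E.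
Proof.
have mF (a : 'I_(M n)) : measurable_fun setT
    (fun x => (\1_(cylinder n (vpoint m a)) x : R)%:E).
  apply/measurable_EFinP; apply: measurable_indic; exact: measurable_cylinder.
have := @ge0_integral_sum _ _ R mu setT measurableT 'I_(M n)
  (fun a x => (\1_(cylinder n (vpoint m a)) x)%:E) mF
  (fun a x _ => ltac:(by rewrite lee_fin)) (index_enum _).
under eq_integral => y _.
  rewrite sumEFin cylinder_partition; over.
rewrite integral_cst //= mul1e => muT.
have : 1%:E = \sum_(a < M n) mu (cylinder n x).
  rewrite -(@probability_setT _ _ _ mu) muT; apply: eq_bigr => a _.
  rewrite integral_indic //; last exact: measurable_cylinder.
  by rewrite setIT; exact: mu_cylinder_translate.
have : mu (cylinder n x) \is a fin_num by apply: fin_num_measure; exact: measurable_cylinder.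
case: (mu _) => // r _; rewrite sumEFin => -[] /esym.
rewrite sumr_const card_ord => h; congr (_%:E).
by rewrite -[LHS](mulKf (lt0r_neq0 (M0 n))) mulr_natl h mulr1.
Qed.

Lemma depends_sum_indic n (g : vilenkin m -> R) x : depends n g ->
  g x = \sum_(a < M n) g (vpoint m a) * \1_(cylinder n (vpoint m a)) x.
Proof.
move=> dg; rewrite -[LHS]mulr1 -(cylinder_partition n x) mulr_sumr.
apply: eq_bigr => a _; rewrite indicE.
have [ax|ax] := pselect (cylinder n (vpoint m a) x); first by rewrite (dg _ _ ax).
by rewrite memNset // !mulr0.
Qed.

Lemma integral_depends n (g : vilenkin m -> R) : depends n g ->
  (forall x, 0 <= g x) -> (\int[mu]_x (g x)%:E = (avg n g)%:E)%E.
Proof.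
move=> dg g0.
have mF (a : 'I_(M n)) : measurable_fun setT
    (fun x => (\1_(cylinder n (vpoint m a)) x : R)%:E).
  apply/measurable_EFinP; apply: measurable_indic; exact: measurable_cylinder.
transitivity (\int[mu]_x (\sum_(a < M n)
    ((g (vpoint m a))%:E * (\1_(cylinder n (vpoint m a)) x)%:E)))%E.
  apply: eq_integral => x _; rewrite (depends_sum_indic x dg) -sumEFin.
  by apply: eq_bigr => a _; rewrite EFinM.
rewrite ge0_integral_sum //; last 2 first.
- by move=> a; apply: emeasurable_funM.
- by move=> a x _; rewrite mule_ge0 // lee_fin.
rewrite /avg mulr_sumr -sumEFin; apply: eq_bigr => a _.
rewrite ge0_integralZl_EFin //.
rewrite integral_indic //; last exact: measurable_cylinder.
by rewrite setIT [X in (_ * X)%E](mu_cylinder n _) -EFinM mulrC.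
Qed.

Lemma integrable_depends n (g : vilenkin m -> R) : depends n g ->
  mu.-integrable setT (fun x => (g x)%:E).
Proof.
move=> dg; apply/integrableP; split.
  by apply/measurable_EFinP; exact: measurable_depends dg.
rewrite (@eq_integral _ _ _ _ _ (fun x => (`|g x|)%:E)) //.
rewrite (integral_depends (n := n)) ?ltry //.
exact: (depends_comp (fun r : R => `|r|)).
Qed.

Lemma Rintegral_depends n (g : vilenkin m -> R) : depends n g ->
  Rintegral mu setT g = avg n g.
Proof.
move=> dg.
have dp : depends n (fun x => Num.max (g x) 0) 
  by exact: (depends_comp (fun r => Num.max r 0)).
have dn : depends n (fun x => Num.max (- g x) 0) 
  by exact: (depends_comp (fun r => Num.max (- r) 0)).
have e x : g x = Num.max (g x) 0 - Num.max (- g x) 0.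
  have [h|/ltW h] := leP 0 (g x).
    have h' : - g x <= 0 by rewrite oppr_le0.
    by rewrite (max_r h') subr0.
  have h' : 0 <= - g x by rewrite oppr_ge0.
  by rewrite (max_l h') sub0r opprK.
rewrite (@eq_Rintegral _ _ _ _ _ (fun x => Num.max (g x) 0 - Num.max (- g x) 0))
  => [|x _]; last exact: e.
rewrite RintegralB //; [|exact: integrable_depends dp|exact: integrable_depends dn].
rewrite /Rintegral !(integral_depends (n := n)) //=; last 2 first.
- by move=> x; rewrite le_max lexx orbT.
- by move=> x; rewrite le_max lexx orbT.
rewrite -mulN1r -avgZ -avgD; apply: eq_avg => x.
by rewrite mulN1r -e.
Qed.

Definition cavg n (g : vilenkin m -> R[i]) : R[i] :=
  (M n)%:R^-1 * \sum_(a < M n) g (vpoint m a).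

Lemma cintegral_depends n (g : vilenkin m -> R[i]) : depends n g ->
  cintegral mu g = cavg n g.
Proof.
move=> dg; rewrite /cintegral.
have -> : Rintegral mu setT (fun x => complex.Re (g x)) =
    avg n (fun x => complex.Re (g x)).
  by apply: Rintegral_depends; exact: (depends_comp (@complex.Re R)).
have -> : Rintegral mu setT (fun x => complex.Im (g x)) =
    avg n (fun x => complex.Im (g x)).
  by apply: Rintegral_depends; exact: (depends_comp (@complex.Im R)).
have Ml : (M n)%:R^-1 = ((M n)%:R^-1)%:C%C :> R[i] by rewrite fmorphV rmorph_nat.
rewrite /cavg Ml /avg.
have -> : \sum_(a < M n) g (vpoint m a) =
  Complex (\sum_(a < M n) complex.Re (g (vpoint m a)))
    (\sum_(a < M n) complex.Im (g (vpoint m a))).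
  elim/big_rec3: _ => // a u v w _ ->.
  by case: (g _).
by apply/eqP; rewrite eq_complex /=; apply/andP; split; apply/eqP; ring.
Qed.

Lemma cintegrable_depends n (g : vilenkin m -> R[i]) : depends n g ->
  cintegrable mu g.
Proof.
move=> dg; split; apply: (integrable_depends (n := n)).
  exact: (depends_comp (@complex.Re R)).
exact: (depends_comp (@complex.Im R)).
Qed.

Lemma Fmeasurable_depends n (g : vilenkin m -> R[i]) : depends n g ->
  Fmeasurable n g.
Proof.
move=> dg; split; apply: measurable_depends_cylinders => //.
  exact: (depends_comp (@complex.Re R)).
exact: (depends_comp (@complex.Im R)).
Qed.

Lemma partial_sumE (c : nat -> R[i]) k x :
  partial_sum c k x = \sum_(i < k) c i * vchar R i x.
Proof. by rewrite /partial_sum big_mkord. Qed.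

Lemma depends_partial_sum (c : nat -> R[i]) n k : (k <= M n)%N ->
  depends n (partial_sum c k : vilenkin m -> _).
Proof.
move=> kM x y xy; rewrite !partial_sumE; apply: eq_bigr => i _.
by rewrite (depends_vchar R m_ge2 (leq_trans (ltn_ord i) kM) xy).
Qed.

Lemma fourier_partial_sum (c : nat -> R[i]) k j :
  fourier mu (partial_sum c k) j = if (j < k)%N then c j else 0.
Proof.
pose n := (k + j)%N.
have kM : (k <= M n)%N by rewrite ltnW // (leq_ltn_trans (leq_addr j k)) // ltn_vprod.
have jM : (j < M n)%N by rewrite (leq_ltn_trans (leq_addl k j)) // ltn_vprod.
rewrite /fourier (cintegral_depends (n := n)); last first.
  move=> x y xy; rewrite (depends_vchar R m_ge2 jM xy).
  by rewrite (depends_partial_sum _ kM xy).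
rewrite /cavg.
under eq_bigr do rewrite partial_sumE mulr_suml.
rewrite exchange_big /=.
under eq_bigr => i _.
  under eq_bigr do rewrite -mulrA.
  rewrite -mulr_sumr vchar_ortho // ?(leq_trans (ltn_ord i)) //; over.
rewrite /=; case: ltnP => jk.
  rewrite (bigD1 (Ordinal jk)) //= eqxx big1 ?addr0.
    by rewrite mulrCA mulVf ?mulr1 // pnatr_eq0 -lt0n vprod_gt0.
  by move=> i; rewrite -val_eqE /= => /negbTE ->; rewrite mulr0.
rewrite big1 ?mulr0 // => i _; case: eqP => [ij|]; last by rewrite mulr0.
by have := ltn_ord i; rewrite ij ltnNge jk.
Qed.

Lemma sub_partial_sum (c : nat -> R[i]) k l : (k <= l)%N ->
  partial_sum (fourier mu (partial_sum c l)) k =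
  partial_sum c k :> (vilenkin m -> R[i]).
Proof.
move=> kl; apply/funext => x; rewrite !partial_sumE; apply: eq_bigr => i _.
by rewrite fourier_partial_sum (leq_trans (ltn_ord i)).
Qed.

Definition coef_martingale (c : nat -> R[i]) : nat -> vilenkin m -> R[i] :=
  fun n => partial_sum c (M n).

Lemma martingale_coef (c : nat -> R[i]) : martingale mu (coef_martingale c).
Proof.
split => [n|n|n l nl].
- by apply: (cintegrable_depends (n := n)); exact: depends_partial_sum.
- by apply: Fmeasurable_depends; exact: depends_partial_sum.
- by apply: sub_partial_sum; exact: leq_vprod.
Qed.

Lemma mfourier_eventually (f : nat -> vilenkin m -> R[i]) i l n0 :
  (forall n, (n0 <= n)%N -> fourier mu (f n) i = l) -> mfourier mu f i = l.
Proof.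
move=> h; apply: (@lim_near_cst R[i]^o) => //.
by exists n0 => // n /=; exact: h.
Qed.

Lemma mfourier_coef (c : nat -> R[i]) : mfourier mu (coef_martingale c) = c.
Proof.
apply/funext => i; apply: (mfourier_eventually (n0 := i)) => n ni.
rewrite fourier_partial_sum ifT //.
by apply: leq_ltn_trans ni _; exact: ltn_vprod.
Qed.

Lemma martingaleE (f : nat -> vilenkin m -> R[i]) : martingale mu f ->
  f = coef_martingale (mfourier mu f).
Proof.
move=> [_ _ fm]; apply/funext => n.
rewrite /coef_martingale -[LHS](fm n n) //; apply/funext => x.
rewrite !partial_sumE; apply: eq_bigr => i _; congr (_ * _).
apply/esym/(mfourier_eventually (n0 := n)) => l nl.
by rewrite -[in RHS](fm n l nl) fourier_partial_sum ltn_ord.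
Qed.

Local Open Scope ereal_scope.

Lemma poweR_cLnorm n (g : vilenkin m -> R[i]) : depends n g ->
  cLnorm mu 2^-1 g `^ 2^-1 = (avg n (fun x => sqn (g x)))%:E.
Proof.
move=> dg; rewrite /cLnorm poweR_Lnorm ?invr_neq0 //.
rewrite -(integral_depends (n := n)) //; last 2 first.
- exact: (depends_comp (@sqn R)).
- by move=> x; exact: sqn_ge0.
apply: eq_integral => x _ /=; congr (_%:E).
by rewrite powR12_sqrt ?normr_ge0 // ger0_norm ?normc_ge0.
Qed.

Lemma maximal_ge0 (f : nat -> vilenkin m -> R[i]) x : 0 <= maximal f x.
Proof.
apply: (@le_trans _ _ (Normc.normc (f 0%N x))%:E); first by rewrite lee_fin normc_ge0.
by apply: ereal_sup_ubound; exists 0%N.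
Qed.

Lemma poweR_Hnorm (f : nat -> vilenkin m -> R[i]) :
  Hnorm mu 2^-1 f `^ 2^-1 = \int[mu]_x (maximal f x `^ 2^-1).
Proof.
rewrite /Hnorm poweR_Lnorm ?invr_neq0 //; apply: eq_integral => x _.
by rewrite gee0_abs ?maximal_ge0.
Qed.

Lemma measurable_maximal (c : nat -> R[i]) :
  measurable_fun setT (maximal (coef_martingale c)).
Proof.
rewrite (_ : maximal _ = fun x =>
    esups (fun n => (Normc.normc (coef_martingale c n x))%:E) 0%N).
  apply: measurable_fun_esups => n; apply/measurable_EFinP.
  apply: (@measurable_depends _ m_ge2 _ _ n).
  by apply: (depends_comp (@Normc.normc R)); exact: depends_partial_sum.
apply/funext => x; rewrite /maximal /esups /=; congr ereal_sup.
by apply/seteqP; split => [_ [n _ <-]|_ [n _ <-]]; exists n.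
Qed.

Lemma sqn_le_maximal (f : nat -> vilenkin m -> R[i]) n x :
  (sqn (f n x))%:E <= maximal f x `^ 2^-1.
Proof.
rewrite /sqn -powR12_sqrt ?normc_ge0 // -poweR_EFin.
apply: gt0_ler_poweR.
- by rewrite invr_ge0.
- by rewrite in_itv /= leey lee_fin normc_ge0.
- by rewrite in_itv /= leey maximal_ge0.
- by apply: ereal_sup_ubound; exists n.
Qed.

Lemma avg_le_Hnorm (c : nat -> R[i]) n :
  (avg n (fun x => sqn (coef_martingale c n x)))%:E <=
  Hnorm mu 2^-1 (coef_martingale c) `^ 2^-1.
Proof.
have dc : depends n (fun x => sqn (coef_martingale c n x)).
  by apply: (depends_comp (@sqn R)); exact: depends_partial_sum.
rewrite poweR_Hnorm -(integral_depends dc); last by move=> x; exact: sqn_ge0.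
apply: ge0_le_integral => //.
- by move=> x _; rewrite lee_fin sqn_ge0.
- by apply/measurable_EFinP; exact: measurable_depends dc.
- exact: measurableT_comp (measurable_poweR _) (measurable_maximal c).
- by move=> x _; exact: sqn_le_maximal.
Qed.

End integrals.

(** * The upper bound *)

Section fejer_means.
Variables (R : realType) (m : nat -> nat).
Hypothesis m_ge2 : forall k, (2 <= m k)%N.
Variable mu : probability (vilenkin m) R.
Hypothesis mu_haar : normalized_haar mu.
Local Notation M := (vprod m).
Implicit Types x y z : vilenkin m.
Local Open Scope complex_scope.

Lemma fejerE (c : nat -> R[i]) k x :
  fejer c k x = k%:R^-1 * \sum_(j < k) partial_sum c j.+1 x.
Proof. by rewrite /fejer big_add1 /= big_mkord. Qed.

Lemma depends_fejer (c : nat -> R[i]) n k : (k <= M n)%N ->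
  depends n (fejer c k : vilenkin m -> _).
Proof.
move=> kM x y xy; rewrite !fejerE; congr (_ * _); apply: eq_bigr => j _.
apply: (depends_partial_sum m_ge2 _ _ xy); exact: leq_trans (ltn_ord j) kM.
Qed.

Lemma partial_sum_convolution (c : nat -> R[i]) n k x : (k <= M n)%N ->
  partial_sum c k x = (M n)%:R^-1 * \sum_(b < M n)
    partial_sum c (M n) (vpoint m b) * dirichlet R k (vsub x (vpoint m b)).
Proof.
move=> kM.
have ce i : (i < k)%N -> c i = (M n)%:R^-1 * \sum_(b < M n)
    partial_sum c (M n) (vpoint m b) * (vchar R i (vpoint m b))^*.
  move=> ik; have iM := leq_trans ik kM.
  rewrite -[LHS](_ : fourier mu (partial_sum c (M n)) i = _); last first.
    by rewrite fourier_partial_sum // iM.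
  rewrite /fourier (cintegral_depends m_ge2 mu_haar (n := n)) // => y z yz.
  rewrite (depends_vchar R m_ge2 iM yz).
  by rewrite (depends_partial_sum m_ge2 _ (leqnn _) yz).
rewrite partial_sumE.
under eq_bigr => i _ do rewrite (ce i (ltn_ord i)) -mulrA mulr_suml.
rewrite -mulr_sumr exchange_big /=; congr (_ * _); apply: eq_bigr => b _.
rewrite /dirichlet mulr_sumr; apply: eq_bigr => i _.
by rewrite vchar_vsub // -mulrA [_^* * _]mulrC.
Qed.

Lemma fejer_convolution (c : nat -> R[i]) n k x : (k <= M n)%N ->
  fejer c k x = k%:R^-1 * ((M n)%:R^-1 * \sum_(b < M n)
    partial_sum c (M n) (vpoint m b) * fejer_sum R k (vsub x (vpoint m b))).
Proof.
move=> kM; rewrite fejerE; congr (_ * _).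
under eq_bigr => j _.
  rewrite (partial_sum_convolution c x (leq_trans (ltn_ord j) kM)); over.
rewrite /= -mulr_sumr exchange_big /=; congr (_ * _); apply: eq_bigr => b _.
by rewrite -mulr_sumr.
Qed.

Variable B : nat.
Hypothesis m_leB : forall k, (m k <= B)%N.

Lemma avg_fejer_level (c : nat -> R[i]) l k : (M l <= k < M l.+1)%N ->
  avg l.+1 (fun x => sqn (fejer c k x)) <=
  Num.sqrt B%:R * (6 * B%:R ^+ 2) * l.+1%:R *
  avg l.+1 (fun x => sqn (coef_martingale c l.+1 x)).
Proof.
move=> /andP[lk kl]; have k0 : (0 < k)%N by apply: leq_trans lk; exact: vprod_gt0.
have kR : 0 < k%:R :> R by rewrite ltr0n.
pose K x := fejer_sum R k x; pose F := @partial_sum m R c (M l.+1).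
have dK : depends l.+1 K by apply: depends_fejer_sum => //; exact: ltnW.
rewrite (@eq_avg R m l.+1 _ (fun x => (Num.sqrt k%:R)^-1 * sqn ((M l.+1)%:R^-1 *
    \sum_(b < M l.+1) F (vpoint m b) * K (vsub x (vpoint m b))))); last first.
  by move=> x; rewrite (fejer_convolution _ _ (ltnW kl)) sqnM sqnV sqn_nat.
rewrite avgZ; have h := avg_convolution m_ge2 F dK.
have hK := avg_fejer_sum R m_ge2 m_leB kl; rewrite -/K in hK.
set aF := avg _ (fun x => sqn (F x)) in h; set aK := avg _ (fun x => sqn (K x)) in h hK.
rewrite -/aF.
have aF0 : 0 <= aF by apply: avg_ge0 => x; exact: sqn_ge0.
have aK0 : 0 <= aK by apply: avg_ge0 => x; exact: sqn_ge0.
have sk : 0 < Num.sqrt k%:R :> R by rewrite sqrtr_gt0.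
have hM : Num.sqrt (M l.+1)%:R <= Num.sqrt B%:R * Num.sqrt k%:R :> R.
  rewrite -sqrtrM ?ler0n // ler_wsqrtr // -natrM ler_nat vprodS.
  exact: leq_mul.
apply: (le_trans (ler_wpM2l _ h)); first by rewrite invr_ge0 ltW.
apply: (@le_trans _ _ ((Num.sqrt k%:R)^-1 * (Num.sqrt B%:R * Num.sqrt k%:R * aF * aK))).
  by rewrite ler_pM2l ?invr_gt0 // ler_wpM2r // ler_wpM2r.
rewrite [X in X <= _](_ : _ = Num.sqrt B%:R * aF * aK * (Num.sqrt k%:R / Num.sqrt k%:R));
  last by ring.
rewrite mulfV ?gt_eqF // mulr1.
rewrite [X in _ <= X](_ : _ = Num.sqrt B%:R * aF * (6 * B%:R ^+ 2 * l.+1%:R));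
  last by ring.
by rewrite ler_wpM2l // mulr_ge0 ?sqrtr_ge0.
Qed.

Lemma level_ln l k n : (M l <= k)%N -> (k <= n)%N -> (2 <= n)%N ->
  l.+1%:R <= 2 / ln 2 * ln n%:R :> R.
Proof.
move=> lk kn n2; have ln2 : 0 < ln (2 : R) by rewrite ln_gt0 // ltr1n.
have nR : 0 < n%:R :> R by rewrite ltr0n ltnW.
rewrite mulrAC ler_pdivlMr //.
have h1 : ln (2 : R) <= ln n%:R by rewrite ler_ln ?posrE ?ler_nat.
have h2 : l%:R * ln 2 <= ln n%:R :> R.
  rewrite mulr_natl -lnXn // ler_ln ?posrE ?exprn_gt0 //.
  rewrite -natrX ler_nat; apply: leq_trans kn; apply: leq_trans lk.
  exact: expn2_vprod.
rewrite -natr1 mulrDl mul1r; lra.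
Qed.

Definition fejer_constant : R := Num.sqrt B%:R * (6 * B%:R ^+ 2) * (2 / ln 2).

Lemma fejer_constant_ge0 : 0 <= fejer_constant.
Proof.
have ln2 : 0 < ln (2 : R) by rewrite ln_gt0 // ltr1n.
rewrite /fejer_constant mulr_ge0 ?divr_ge0 ?(ltW ln2) //.
Qed.

Local Open Scope ereal_scope.

Lemma cLnorm_fejer_le (c : nat -> R[i]) k n : (0 < k <= n)%N -> (2 <= n)%N ->
  cLnorm mu 2^-1 (fejer c k) `^ 2^-1 <=
  (fejer_constant * ln n%:R)%:E * Hnorm mu 2^-1 (coef_martingale c) `^ 2^-1.
Proof.
move=> /andP[k0 kn] n2; have [l lk] := exists_level m_ge2 k0.
have lnn : (0 <= ln (n%:R : R))%R by rewrite ln_ge0 // ler1n ltnW.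
have dk : depends l.+1 (fejer c k : vilenkin m -> R[i]).
  by apply: depends_fejer; case/andP: lk => _ /ltnW.
rewrite (poweR_cLnorm m_ge2 mu_haar dk).
have := avg_fejer_level c lk; rewrite -lee_fin => /le_trans; apply.
rewrite EFinM; apply: lee_pmul.
- by rewrite lee_fin mulr_ge0.
- by rewrite lee_fin; apply: avg_ge0 => x; exact: sqn_ge0.
- rewrite lee_fin /fejer_constant -[X in (_ <= X)%R]mulrA ler_wpM2l ?mulr_ge0 //.
  by case/andP: lk => /level_ln h _; exact: h kn n2.
- exact: avg_le_Hnorm.
Qed.

Lemma strong_fejer_le (c : nat -> R[i]) n : (2 <= n)%N ->
  ((n%:R * ln n%:R)^-1)%:E *
    \sum_(1 <= k < n.+1) cLnorm mu 2^-1 (fejer c k) `^ 2^-1 <=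
  fejer_constant%:E * Hnorm mu 2^-1 (coef_martingale c) `^ 2^-1.
Proof.
move=> n2; set H := Hnorm _ _ _ `^ _.
have lnn : (0 < ln (n%:R : R))%R by rewrite ln_gt0 // ltr1n.
have nR : (0 < n%:R :> R)%R by rewrite ltr0n ltnW.
apply: (@le_trans _ _ (((n%:R * ln n%:R)^-1)%:E *
    \sum_(1 <= k < n.+1) ((fejer_constant * ln n%:R)%:E * H))).
  apply: lee_wpmul2l; first by rewrite lee_fin invr_ge0 mulr_ge0 ?ltW.
  rewrite big_nat [leRHS]big_nat; apply: lee_sum => k /andP[k1 kn].
  by apply: cLnorm_fejer_le; rewrite // k1.
rewrite -ge0_sume_distrl; last first.
  by move=> k _; rewrite lee_fin mulr_ge0 ?fejer_constant_ge0 // ltW.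
rewrite sumEFin sumr_const_nat subn1 /= muleA -EFinM -[X in (_ * X)%R]mulr_natl.
rewrite [X in X%:E * _ <= _](_ : _ = fejer_constant) //.
by field; rewrite !gt_eqF.
Qed.

End fejer_means.

(** * The divergent example *)

Section lacunary.
Variables (R : realType) (m : nat -> nat) (B : nat).
Hypothesis m_ge2 : forall k, (2 <= m k)%N.
Hypothesis m_leB : forall k, (m k <= B)%N.
Local Notation M := (vprod m).
Implicit Types x y z : vilenkin m.
Variable N : nat -> nat.
Hypothesis N_mono : forall k, (N k < N k.+1)%N.

Definition in_block k j := (M (N k) <= j < M (N k).+1)%N.

Definition weight k : R[i] := ((2 ^ k.+1)%:R * (2 ^ k.+1)%:R)^-1.

(* The sum has at most one nonzero term: the blocks are disjoint, and the k-th one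
   lies beyond M_{N k} > k. *)
Definition lacunary (j : nat) : R[i] :=
  \sum_(k < j.+1) (in_block k j)%:R * (weight k * (M (N k))%:R).

Lemma ltn_levels k k' : (k < k')%N -> (N k < N k')%N.
Proof. by apply: (homo_ltn ltn_trans). Qed.

Lemma leq_level k : (k <= N k)%N.
Proof. by elim: k => // k IH; apply: leq_ltn_trans IH (N_mono k). Qed.

Lemma in_block_leq k j : in_block k j -> (k < j.+1)%N.
Proof.
move=> /andP[Mj _]; rewrite ltnS; apply: leq_trans Mj.
exact: leq_trans (leq_level k) (ltnW (ltn_vprod m_ge2 _)).
Qed.

Lemma in_block_uniq k k' j : in_block k j -> in_block k' j -> k = k'.
Proof.
have aux a b : (a < b)%N -> in_block a j -> in_block b j -> False.
  move=> /ltn_levels /(leq_vprod m_ge2) ab /andP[_ ja] /andP[bj _].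
  by have := leq_trans ja (leq_trans ab bj); rewrite ltnn.
move=> bk bk'; case: (ltngtP k k') => // h.
  by case: (aux _ _ h bk bk').
by case: (aux _ _ h bk' bk).
Qed.

Lemma lacunary_block k j : in_block k j -> lacunary j = weight k * (M (N k))%:R.
Proof.
move=> bk; rewrite /lacunary (bigD1 (Ordinal (in_block_leq bk))) //= bk mul1r.
rewrite big1 ?addr0 // => k' kk'; case bk' : (in_block k' j); rewrite ?mul0r //.
by move: kk'; rewrite -val_eqE /= (in_block_uniq bk' bk) eqxx.
Qed.

Lemma lacunary_gap j : (forall k, ~~ in_block k j) -> lacunary j = 0.
Proof. by move=> nb; rewrite /lacunary big1 // => k _; rewrite (negbTE (nb k)) mul0r. Qed.

Lemma sqn_weight k : sqn (weight k) = (2 ^ k.+1)%:R^-1.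
Proof. by rewrite /weight sqnV sqn_sqr_nat. Qed.

Lemma normc_weight k : Normc.normc (weight k) <= 1.
Proof.
rewrite /weight Normc.normcV -natrM normc_nat invf_le1.
  by rewrite ler1n muln_gt0 expn_gt0.
by rewrite ltr0n muln_gt0 expn_gt0.
Qed.

Lemma normc_lacunary j : Normc.normc (lacunary j) <= j%:R.
Proof.
have [[k bk]|nb] := pselect (exists k, in_block k j); last first.
  rewrite lacunary_gap ?Normc.normc0 ?ler0n // => k; apply/negP => bk.
  by apply: nb; exists k.
rewrite (lacunary_block bk) Normc.normcM normc_nat.
case/andP: bk => Mj _; apply: (@le_trans _ _ (M (N k))%:R); last by rewrite ler_nat.
by rewrite ler_piMl ?normc_weight.
Qed.

Definition gap_start k := if k is k'.+1 then (N k').+1 else 0%N.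

Lemma lacunary_before k j : (M (gap_start k) <= j < M (N k))%N -> lacunary j = 0.
Proof.
move=> /andP[gj jN]; apply: lacunary_gap => k'; apply/negP => /andP[b1 b2].
case: (ltnP k' k) => h.
  move: gj; rewrite leqNgt => /negP; apply; apply: leq_trans b2 _.
  apply: leq_vprod => //; case: k h {jN} => // k; rewrite ltnS /= ltnS.
  by rewrite leq_eqVlt => /orP[/eqP ->|/ltn_levels /ltnW].
have : (N k <= N k')%N by move: h; rewrite leq_eqVlt => /orP[/eqP ->|/ltn_levels /ltnW].
by move=> /(leq_vprod m_ge2) NN; have := leq_trans jN (leq_trans NN b1); rewrite ltnn.
Qed.

Lemma normc_lacunary_sum k j x : (j <= M (N k))%N ->
  Normc.normc (partial_sum lacunary j x) <= (M (gap_start k))%:R ^+ 2.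
Proof.
move=> jN; rewrite partial_sumE; apply: le_trans (normc_sum _ _ _) _.
set g := M (gap_start k).
apply: (@le_trans _ _ (\sum_(i < j) (if (i < g)%N then g%:R else 0))).
  apply: ler_sum => i _; rewrite Normc.normcM normc_vchar mulr1.
  case: ltnP => h; first by apply: le_trans (normc_lacunary i) _; rewrite ler_nat ltnW.
  rewrite (lacunary_before (k := k)) ?Normc.normc0 //.
  by rewrite h (leq_trans (ltn_ord i)).
case: (leqP j g) => h.
  apply: (@le_trans _ _ (\sum_(i < j) g%:R)).
    by apply: ler_sum => i _; case: ifP.
  by rewrite sumr_const card_ord -[X in X <= _]mulr_natl expr2 ler_wpM2r // ler_nat.
rewrite -(subnKC (ltnW h)) (sum_ord_addn _ _ (fun i => if (i < g)%N then g%:R else 0)).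
rewrite [X in _ + X]big1 ?addr0 => [|i _]; last by rewrite ltnNge leq_addr.
under eq_bigr do rewrite ltn_ord.
by rewrite sumr_const card_ord -[X in X <= _]mulr_natl expr2.
Qed.

Lemma fejer_lacunary_split k i x : (i < M (N k))%N ->
  exists2 p : R[i], Normc.normc p <= (M (N k) + i)%:R * (M (gap_start k))%:R ^+ 2 &
  \sum_(j < M (N k) + i) partial_sum lacunary j.+1 x =
  p + weight k * (M (N k))%:R * (rademacher R (N k) x * fejer_sum R i x).
Proof.
move=> iM; set n := N k.
pose p : R[i] := \sum_(j < M n) partial_sum lacunary j.+1 x
  + i%:R * partial_sum lacunary (M n) x.
exists p.
  apply: le_trans (ler_normcD _ _) _; rewrite natrD mulrDl; apply: lerD.
    apply: le_trans (normc_sum _ _ _) _.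
    apply: (@le_trans _ _ (\sum_(j < M n) (M (gap_start k))%:R ^+ 2)).
      by apply: ler_sum => j _; exact: normc_lacunary_sum.
    by rewrite sumr_const card_ord mulr_natl.
  by rewrite Normc.normcM normc_nat ler_wpM2l // normc_lacunary_sum.
rewrite (sum_ord_addn _ _ (fun j => partial_sum lacunary j.+1 x)) /p -addrA.
congr (_ + _).
transitivity (\sum_(j < i) (partial_sum lacunary (M n) x +
   weight k * (M n)%:R * rademacher R n x * dirichlet R j.+1 x)).
  apply: eq_bigr => j _; rewrite -addnS !partial_sumE.
  rewrite (sum_ord_addn _ _ (fun i => lacunary i * vchar R i x)); congr (_ + _).
  rewrite /dirichlet mulr_sumr; apply: eq_bigr => i' _.
  have i'M : (i' < M n)%N.
    by apply: leq_trans (ltn_ord i') _; exact: ltn_trans (ltn_ord j) iM.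
  rewrite (lacunary_block (k := k)); last first.
    rewrite /in_block leq_addr /= vprodS.
    apply: (@leq_trans (2 * M n)); last by rewrite leq_mul2r m_ge2 orbT.
    by rewrite mul2n -addnn ltn_add2l.
  have := vcharS R m_ge2 x (s := 1) (m_ge2 n) i'M; rewrite mul1n expr1 => ->.
  by rewrite !mulrA.
rewrite big_split /= sumr_const card_ord; congr (_ + _).
  by rewrite mulr_natl.
by rewrite mulrA /fejer_sum mulr_sumr.
Qed.

Lemma sqn_fejer_lacunary k i x : (i < M (N k))%N ->
  (2 ^ k.+2)%:R^-1 * sqn (fejer_sum R i x) - (M (gap_start k))%:R <=
  sqn (fejer lacunary (M (N k) + i) x).
Proof.
move=> iM; have [p pb e] := fejer_lacunary_split x iM.
set n := (M (N k) + i)%N in pb e *.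
have n0 : 0 < n%:R :> R by rewrite ltr0n addn_gt0 vprod_gt0.
have MN0 : 0 < (M (N k))%:R :> R by rewrite ltr0n vprod_gt0.
rewrite fejerE e mulrDr [X in _ <= sqn X]addrC.
apply: le_trans (ler_sqnB _ _); apply: lerB; last first.
  apply: ler_sqn; first exact: ler0n.
  rewrite Normc.normcM Normc.normcV normc_nat.
  by rewrite -[X in _ <= X](mulKf (lt0r_neq0 n0)) ler_wpM2l ?invr_ge0.
rewrite !sqnM sqnV !sqn_nat sqn_weight.
rewrite (sqn_unit (normc_rademacher _ _ _)) mul1r !mulrA ler_wpM2r ?sqn_ge0 //.
have sn : 0 < Num.sqrt n%:R :> R by rewrite sqrtr_gt0.
rewrite -mulrA [X in _ <= X]mulrC ler_pdivlMr // expnS natrM invfM.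
rewrite [X in X <= _](_ : _ = (2 ^ k.+1)%:R^-1 * (2^-1 * Num.sqrt n%:R)); last by ring.
rewrite ler_pM2l ?invr_gt0 ?ltr0n ?expn_gt0 // mulrC ler_pdivrMr //.
rewrite -[2](ger0_norm (ler0n R 2)) -sqrtr_sqr -sqrtrM ?ler0n // ler_wsqrtr //.
rewrite -natrX -natrM ler_nat /n; lia.
Qed.

Lemma sum_avg_fejer_lacunary k :
  (M (N k))%:R * (((N k)%:R - 1) / (4 * B%:R * (2 ^ k.+2)%:R)
     - (M (gap_start k))%:R) <=
  \sum_(i < M (N k)) avg (N k).+1 (fun x => sqn (fejer lacunary (M (N k) + i) x)).
Proof.
apply: (@le_trans _ _ (\sum_(i < M (N k)) ((2 ^ k.+2)%:R^-1 *
    avg (N k) (fun x => sqn (fejer_sum R i x : R[i])) - (M (gap_start k))%:R))); last first.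
  apply: ler_sum => i _.
  have dG : depends (N k) (fun x => sqn (fejer_sum R i x)).
    exact: (depends_sqn_fejer_sum R m_ge2 (ltnW (ltn_ord i))).
  rewrite -(avgS m_ge2 dG) -avgZ.
  have avgc : avg (N k).+1 (fun _ : vilenkin m => (M (gap_start k))%:R : R) =
      (M (gap_start k))%:R.
    rewrite /avg sumr_const card_ord -[X in _ * X]mulr_natl mulKf //.
    by rewrite pnatr_eq0 -lt0n vprod_gt0.
  rewrite -avgc -mulN1r -avgZ -avgD; apply: ler_avg => x; rewrite mulN1r.
  exact: sqn_fejer_lacunary.
rewrite sumrB sumr_const card_ord -mulr_sumr -[X in _ <= _ - X]mulr_natl mulrBr lerB //.
have h := sum_avg_fejer R m_ge2 m_leB (N k).
apply: le_trans (ler_wpM2l _ h); last by rewrite invr_ge0.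
rewrite [X in X <= _](_ : _ = (2 ^ k.+2)%:R^-1 *
  ((M (N k))%:R * ((N k)%:R - 1) / (4 * B%:R))) //.
by rewrite !invfM; ring.
Qed.

Lemma lacunary_partial_sum n x : partial_sum lacunary (M n) x =
  \sum_(k < n) weight k * ((M (N k))%:R *
     \sum_(j < M n) (in_block k j)%:R * vchar R j x).
Proof.
have widen j : (j < M n)%N -> lacunary j =
    \sum_(k < n) (in_block k j)%:R * (weight k * (M (N k))%:R).
  move=> jn; have [[k bk]|nb] := pselect (exists k, in_block k j); last first.
    rewrite lacunary_gap => [|k]; last by apply/negP => bk; apply: nb; exists k.
    rewrite big1 // => k _; case bk : (in_block k j); rewrite ?mul0r //.
    by case: nb; exists k.
  have kn : (k < n)%N.
    apply: leq_ltn_trans (leq_level k) _; rewrite ltnNge; apply/negP.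
    move=> /(leq_vprod m_ge2) nN; case/andP: bk => Mj _.
    by have := leq_trans jn (leq_trans nN Mj); rewrite ltnn.
  rewrite (lacunary_block bk) (bigD1 (Ordinal kn)) //= bk mul1r big1 ?addr0 //.
  move=> k' kk'; case bk' : (in_block k' j); rewrite ?mul0r //.
  by move: kk'; rewrite -val_eqE /= (in_block_uniq bk' bk) eqxx.
rewrite partial_sumE.
under eq_bigr => j _ do rewrite (widen _ (ltn_ord j)) mulr_suml.
rewrite exchange_big /=; apply: eq_bigr => k _; rewrite !mulr_sumr.
by apply: eq_bigr => j _; ring.
Qed.

Lemma block_sum k n x :
  \sum_(j < M n) (in_block k j)%:R * vchar R j x =
  if (N k < n)%N then dirichlet R (M (N k).+1) x - dirichlet R (M (N k)) x else 0.
Proof.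
case: ltnP => h; last first.
  rewrite big1 // => j _; rewrite /in_block leqNgt.
  by rewrite (leq_trans (ltn_ord j)) ?mul0r //; exact: leq_vprod.
have h1 : (M (N k).+1 <= M n)%N by exact: leq_vprod.
have h2 : (M (N k) <= M (N k).+1)%N by exact: leq_vprod.
pose F j : R[i] := (in_block k j)%:R * vchar R j x.
rewrite -(subnKC h1) (sum_ord_addn _ _ F) [X in _ + X]big1 ?addr0 => [|j _]; last first.
  by rewrite /F /in_block [X in _ && X]ltnNge leq_addr andbF mul0r.
rewrite /dirichlet -(subnKC h2) (sum_ord_addn _ _ F) (sum_ord_addn _ _ (fun j => vchar R j x)).
rewrite [X in X + _ = _]big1 ?add0r => [|j _]; last first.
  by rewrite /F /in_block leqNgt ltn_ord mul0r.
rewrite [RHS]addrAC subrr add0r; apply: eq_bigr => j _; rewrite /F /in_block leq_addr /=.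
by rewrite -ltn_subRL ltn_ord mul1r.
Qed.

Lemma sqn_block k n x :
  sqn ((M (N k))%:R * \sum_(j < M n) (in_block k j)%:R * vchar R j x) <=
  (M (N k))%:R * B%:R * (near0 (N k) x)%:R.
Proof.
rewrite block_sum; case: ifP => _; last by rewrite mulr0 sqn0 !mulr_ge0.
rewrite dirichletS // -[X in _ - X]mul1r -mulrBl mulrA.
apply: (ler_sqn_dirichlet m_ge2) => //.
rewrite Normc.normcM normc_nat ler_wpM2l //.
apply: (@le_trans _ _ (m (N k))%:R).
  rewrite geom_full //; case: eqP => _; last first.
    by rewrite sub0r normc_opp Normc.normc1 ler1n (leq_trans _ (m_ge2 _)).
  have m1 : (1 <= m (N k))%N by rewrite (leq_trans _ (m_ge2 _)).
  by rewrite -[1]/(1%:R) -natrB // normc_nat ler_nat leq_subr.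
rewrite -natrX ler_nat; apply: leq_trans (m_leB _) _.
rewrite -{1}[B]expn1 leq_exp2l // (leq_trans (m_ge2 0)) //.
Qed.

Definition majorant k x : R :=
  (2 ^ k.+1)%:R^-1 * ((M (N k))%:R * B%:R * (near0 (N k) x)%:R).

Lemma majorant_ge0 k x : 0 <= majorant k x.
Proof. by rewrite /majorant !mulr_ge0 // invr_ge0. Qed.

Lemma depends_majorant k : depends (N k) (majorant k).
Proof. by move=> x y xy; rewrite /majorant (depends_near0_natr R xy). Qed.

Lemma sqn_lacunary_le n x :
  sqn (partial_sum lacunary (M n) x) <= \sum_(k < n) majorant k x.
Proof.
rewrite lacunary_partial_sum; apply: le_trans (sqn_sum _ _ _) _.
apply: ler_sum => k _; rewrite sqnM sqn_weight /majorant ler_wpM2l ?invr_ge0 //.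
exact: sqn_block.
Qed.

Variable mu : probability (vilenkin m) R.
Hypothesis mu_haar : normalized_haar mu.
Local Open Scope ereal_scope.

Lemma integral_majorant k :
  \int[mu]_x (majorant k x)%:E = (B%:R / (2 ^ k.+1)%:R)%:E.
Proof.
rewrite (integral_depends m_ge2 mu_haar (depends_majorant (k := k))); last first.
  exact: majorant_ge0.
congr (_%:E); rewrite /majorant avgZ avgZ avg_near0 // mulrC; congr (_ * _)%R.
by rewrite mulrAC mulfV ?mul1r // pnatr_eq0 -lt0n vprod_gt0.
Qed.

Lemma Hnorm_lacunary_lt : Hnorm mu 2^-1 (coef_martingale lacunary) < +oo.
Proof.
apply: (@lty_poweRy _ _ 2^-1); first by rewrite invr_neq0.
rewrite poweR_Hnorm.
have mm k : measurable_fun setT (fun x => (majorant k x)%:E).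
  apply/measurable_EFinP; apply: (measurable_depends m_ge2); exact: depends_majorant.
have m0 k x : 0 <= (majorant k x)%:E by rewrite lee_fin majorant_ge0.
apply: (@le_lt_trans _ _ (\int[mu]_x \sum_(k <oo) (majorant k x)%:E)).
  apply: ge0_le_integral => //.
  - by move=> x _; exact: poweR_ge0.
  - exact: measurableT_comp (measurable_poweR _) (measurable_maximal _ _).
  - by apply: ge0_emeasurable_sum.
  move=> x _; set h := \sum_(k <oo) _.
  have h0 : 0 <= h by exact: nneseries_ge0.
  have hn n : (sqn (coef_martingale lacunary n x))%:E <= h.
    apply: (@le_trans _ _ (\sum_(0 <= k < n) (majorant k x)%:E)).
      by rewrite sumEFin lee_fin big_mkord; exact: sqn_lacunary_le.
    exact: nneseries_lim_ge.
  have -> : h = (h `^ 2) `^ 2^-1 by rewrite -poweRrM mulfV // poweRe1.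
  apply: gt0_ler_poweR.
  - by rewrite invr_ge0.
  - by rewrite in_itv /= leey maximal_ge0.
  - by rewrite in_itv /= leey poweR_ge0.
  apply: ge_ereal_sup => _ [n _ <-].
  have -> : Normc.normc (coef_martingale lacunary n x) =
      (sqn (coef_martingale lacunary n x) `^ 2)%R.
    by rewrite powR_mulrn ?sqn_ge0 // sqr_sqrtr // normc_ge0.
  rewrite -poweR_EFin; apply: gt0_ler_poweR => //.
  - by rewrite in_itv /= leey lee_fin sqn_ge0.
  - by rewrite in_itv /= leey h0.
rewrite integral_nneseries //.
under eq_eseriesr do rewrite integral_majorant.
apply: (@le_lt_trans _ _ (B%:R)%:E); last exact: ltry.
exact: epsilon_trick0.
Qed.

Lemma hardy_lacunary : hardy mu 2^-1 (coef_martingale lacunary).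
Proof. by split; [exact: martingale_coef|exact: Hnorm_lacunary_lt]. Qed.

End lacunary.

Section divergence.
Variables (R : realType) (m : nat -> nat) (B : nat).
Hypothesis m_ge2 : forall k, (2 <= m k)%N.
Hypothesis m_leB : forall k, (m k <= B)%N.
Local Notation M := (vprod m).
Implicit Types x y z : vilenkin m.

Let B_ge2 : (2 : R) <= B%:R.
Proof. by rewrite ler_nat; exact: leq_trans (m_ge2 0) (m_leB 0). Qed.

Lemma fejer_partial_sum (c : nat -> R[i]) n k : (k <= M n)%N ->
  exists d : nat -> R[i], fejer c k = partial_sum d (M n) :> (vilenkin m -> R[i]).
Proof.
move=> kM; exists (fun i => k%:R^-1 * (\sum_(j < k) (i < j.+1)%:R) * c i).
apply/funext => x; rewrite fejerE partial_sumE.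
have e j : (j < k)%N -> partial_sum c j.+1 x =
    \sum_(i < M n) (i < j.+1)%:R * (c i * vchar R i x).
  move=> jk; have jM : (j.+1 <= M n)%N by exact: leq_trans jk kM.
  rewrite partial_sumE -(subnKC jM).
  rewrite (sum_ord_addn _ _ (fun i => (i < j.+1)%:R * (c i * vchar R i x))).
  rewrite [X in _ = _ + X]big1 ?addr0 => [|i _]; last by rewrite ltnNge leq_addr mul0r.
  by apply: eq_bigr => i _; rewrite ltn_ord mul1r.
under eq_bigr => j _ do rewrite (e _ (ltn_ord j)).
rewrite exchange_big mulr_sumr; apply: eq_bigr => i _ /=.
by rewrite -mulr_suml !mulrA.
Qed.

Lemma vprod_leq_exp n : (M n <= B ^ n)%N.
Proof.
elim: n => [|n IH]; first by rewrite vprod0.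
by rewrite vprodS expnS leq_mul.
Qed.

Lemma limn_esup_gt (u : nat -> R) (L : R) n0 :
  limn_esup (fun n => (u n)%:E) = +oo%E -> exists2 n, (n0 <= n)%N & L < u n.
Proof.
move=> u_oo.
have : (+oo <= ereal_sup [set (u n)%:E | n in [set n | (n0 <= n)%N]])%E.
  rewrite -u_oo; apply: ereal_inf_lbound => /=.
  by exists [set n | (n0 <= n)%N] => //; exists n0.
rewrite leye_eq => /eqP sup_oo.
have /ereal_sup_gt [_ [n /= n0n <-]] :
    (L%:E < ereal_sup [set (u n)%:E | n in [set n | (n0 <= n)%N]])%E.
  by rewrite sup_oo ltry.
by rewrite lte_fin => Lu; exists n.
Qed.

Variable phi : nat -> R.
Hypothesis phi_ge1 : forall n, (1 <= n)%N -> 1 <= phi n.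
Hypothesis phi_mono : forall n n', (1 <= n)%N -> (n <= n')%N -> phi n <= phi n'.
Hypothesis phi_slow : limn_esup (fun n => (ln n%:R / phi n)%:E) = +oo%E.

Lemma exists_good_level (e A K : R) (P : nat) : 0 < e -> 0 <= K ->
  exists2 n, (P <= n)%N & K * phi (2 * M n) <= e * n%:R - A.
Proof.
move=> e0 K0.
have [n1 n1A] : exists n1 : nat, 2 * A / e < n1%:R.
  exists (Num.truncn `|2 * A / e|).+1.
  by apply: le_lt_trans (ler_norm _) _; exact: truncnS_gt.
pose n0 := (maxn P n1).+1.
pose L := 6 * B%:R * K / e.
have L0 : 0 <= L by rewrite /L divr_ge0 ?(ltW e0) // mulr_ge0 // mulr_ge0.
have [n nn0 nL] := limn_esup_gt L (2 * M n0) phi_slow.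
have n2 : (M n0 <= n./2)%N by rewrite geq_half_double -mul2n.
have [l /andP[lk nl]] := exists_level m_ge2 (leq_trans (vprod_gt0 m_ge2 n0) n2).
have n0l : (n0 <= l)%N.
  rewrite leqNgt; apply/negP => /(leq_vprod m_ge2) h.
  by have := leq_trans nl (leq_trans h n2); rewrite ltnn.
exists l; first by apply: leq_trans n0l; rewrite ltnW // ltnS leq_maxl.
have n1l : (n1%:R : R) <= l%:R by rewrite ler_nat (leq_trans _ n0l) // ltnW // ltnS leq_maxr.
have l1 : (1 : R) <= l%:R by rewrite ler1n (leq_trans _ n0l).
have Ml2 : (0 < 2 * M l)%N by rewrite muln_gt0 vprod_gt0.
have Mln : (2 * M l <= n)%N by rewrite mul2n -geq_half_double.
have nB : (n <= B ^ l.+2)%N.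
  apply: (@leq_trans (2 * M l.+1)).
    rewrite -[n]odd_double_half -mul2n; case: (odd n); lia.
  rewrite expnS leq_mul ?vprod_leq_exp //.
  exact: leq_trans (m_ge2 0) (m_leB 0).
have phin : 0 < phi n.
  by apply: lt_le_trans ltr01 (phi_ge1 _); exact: leq_trans Ml2 Mln.
have n0R : 0 < n%:R :> R by rewrite ltr0n (leq_trans Ml2).
have B0 : 0 < B%:R :> R by have := B_ge2; lra.
have lnn : ln n%:R <= 3 * l%:R * B%:R :> R.
  apply: (@le_trans _ _ (ln (B%:R ^+ l.+2))).
    by rewrite ler_ln ?posrE ?exprn_gt0 // -natrX ler_nat.
  rewrite lnXn // -[X in X <= _]mulr_natl; apply: ler_pM => //.
  - by rewrite ln_ge0 //; have := B_ge2; lra.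
  - by rewrite -[l.+2]addn2 natrD; lra.
  - by apply: ltW; apply: ln_sublinear.
have h1 : L * phi n <= 3 * l%:R * B%:R.
  by apply: le_trans lnn; rewrite -ler_pdivlMr // ltW.
have h2 : phi (2 * M l) <= phi n by exact: phi_mono.
have h3 : K * phi n <= e * l%:R / 2.
  have : 6 * B%:R * (K * phi n) <= 6 * B%:R * (e * l%:R / 2).
    rewrite [X in X <= _](_ : _ = L * phi n * e).
      rewrite [X in _ <= X](_ : _ = 3 * l%:R * B%:R * e); last by field.
      by rewrite ler_pM2r.
    by rewrite /L; field; rewrite gt_eqF.
  by rewrite ler_pM2l // mulr_gt0.
have h4 : 2 * A <= e * l%:R.
  have : 2 * A / e <= l%:R by apply: le_trans (ltW n1A) n1l.
  by rewrite ler_pdivrMr // [l%:R * e]mulrC.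
have h5 : K * phi (2 * M l) <= K * phi n by rewrite ler_wpM2l.
lra.
Qed.

Variable mu : probability (vilenkin m) R.
Hypothesis mu_haar : normalized_haar mu.

Lemma avg_fejer_le_Hnorm (c : nat -> R[i]) n k : (k <= M n)%N ->
  ((avg n (fun x => sqn (fejer c k x)))%:E <=
   poweR (Hnorm mu 2^-1 (of_function mu (fejer c k))) 2^-1)%E.
Proof.
move=> kM; have [d e] := fejer_partial_sum c kM.
have := avg_le_Hnorm m_ge2 mu_haar (fourier mu (fejer c k)) n.
by rewrite {1}/coef_martingale e sub_partial_sum.
Qed.

Definition rate k : R := (2 * (4 * B%:R * (2 ^ k.+2)%:R))^-1.

Lemma rate_gt0 k : 0 < rate k.
Proof.
rewrite invr_gt0 !mulr_gt0 ?ltr0n ?expn_gt0 //.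
by apply: leq_trans (m_leB 0); apply: leq_trans (m_ge2 0).
Qed.

Lemma strong_fejer_lacunary_ge (N : nat -> nat) k :
  (forall k, (N k < N k.+1)%N) ->
  k%:R * phi (2 * M (N k)) <=
    rate k * (N k)%:R - (rate k + (M (gap_start N k))%:R) ->
  (k%:R%:E <= (((2 * M (N k))%:R * phi (2 * M (N k)))^-1)%:E *
    \sum_(1 <= j < (2 * M (N k)).+1)
      poweR (Hnorm mu 2^-1 (of_function mu (fejer (lacunary R m N) j))) 2^-1)%E.
Proof.
move=> N_mono hk; set n := M (N k); set c := lacunary R m N.
have n0 : (0 < n)%N by exact: vprod_gt0.
have n0R : 0 < n%:R :> R by rewrite ltr0n.
have ph0 : 0 < phi (2 * n).
  by apply: lt_le_trans ltr01 (phi_ge1 _); rewrite muln_gt0.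
have D0 : 0 < (2 * n)%:R * phi (2 * n) by rewrite mulr_gt0 // ltr0n muln_gt0.
have S := sum_avg_fejer_lacunary R m_ge2 m_leB N_mono k.
apply: (@le_trans _ _ (((2 * n)%:R * phi (2 * n))^-1 *
   \sum_(i < n) avg (N k).+1 (fun x => sqn (fejer c (n + i) x)))%:E).
  rewrite lee_fin mulrC ler_pdivlMr //.
  apply: le_trans S; rewrite -/n natrM.
  rewrite [X in X <= _](_ : _ = n%:R * (2 * (k%:R * phi (2 * n)%N))); last by ring.
  rewrite ler_pM2l //.
  have -> : (4 * B%:R * (2 ^ k.+2)%:R)^-1 = 2 * rate k.
    by rewrite /rate [X in _ = 2 * X]invfM [RHS]mulrA mulfV ?mul1r // pnatr_eq0.
  move: hk; rewrite -/n; have := ler0n R (M (gap_start N k)); lra.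
rewrite EFinM -sumEFin; apply: lee_wpmul2l; first by rewrite lee_fin invr_ge0 ltW.
have nn : (n <= (2 * n).+1)%N by lia.
rewrite (big_cat_nat (n := n)) //= (@big_cat_nat _ _ _ (2 * n) n (2 * n).+1) //=; [|lia].
apply: (@le_trans _ _ (\sum_(n <= j < 2 * n)
      poweR (Hnorm mu 2^-1 (of_function mu (fejer c j))) 2^-1)%E).
  have -> : \sum_(n <= j < 2 * n)
      poweR (Hnorm mu 2^-1 (of_function mu (fejer c j))) 2^-1 =
      \sum_(0 <= i < n)
      poweR (Hnorm mu 2^-1 (of_function mu (fejer c (i + n)))) 2^-1.
    by rewrite -[X in index_iota X _]add0n big_addn mul2n -addnn addnK.
  rewrite big_mkord.
  apply: lee_sum => i _; rewrite addnC; apply: avg_fejer_le_Hnorm.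
  rewrite vprodS; apply: (@leq_trans (2 * n)); last by rewrite leq_mul2r m_ge2 orbT.
  by have := ltn_ord i; lia.
apply: le_trans (leeDr _ _) _; last first.
  by apply: leeD2l; apply: leeDl; apply: sume_ge0 => j _; exact: poweR_ge0.
by apply: sume_ge0 => j _; exact: poweR_ge0.
Qed.

Lemma strong_fejer_diverges :
  exists f : nat -> vilenkin m -> R[i], hardy mu 2^-1 f /\
    ereal_sup [set (((n%:R * phi n)^-1)%:E *
        \sum_(1 <= k < n.+1)
          poweR (Hnorm mu 2^-1
            (of_function mu (fejer (mfourier mu f) k))) 2^-1)%E
      | n in [set n : nat | (1 <= n)%N]] = +oo%E.
Proof.
have /choice [next nextP] : forall kP : nat * nat, exists n : nat,
    (kP.2 <= n)%N /\ kP.1%:R * phi (2 * M n) <=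
      rate kP.1 * n%:R - (rate kP.1 + (M kP.2)%:R).
  move=> [k P].
  have [n Pn h] := @exists_good_level (rate k) (rate k + (M P)%:R) k%:R P
    (rate_gt0 k) (ler0n _ _).
  by exists n.
pose N := fix N k := if k is k'.+1 then next (k'.+1, (N k').+1) else next (0, 0)%N.
have NE k : N k = next (k, gap_start N k) by case: k.
have N_mono k : (N k < N k.+1)%N by rewrite [N k.+1]NE; exact: (nextP (k.+1, (N k).+1)).1.
exists (coef_martingale (lacunary R m N)); split.
  exact: hardy_lacunary.
rewrite mfourier_coef //; apply: eq_infty => r.
pose k := (Num.truncn `|r|).+1.
apply: (@le_trans _ _ k%:R%:E).
  by rewrite lee_fin (le_trans (ler_norm r)) // ltW // truncnS_gt.
apply: le_trans (@strong_fejer_lacunary_ge N k N_mono _) _.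
  by rewrite NE; exact: (nextP (k, gap_start N k)).2.
apply: ereal_sup_ubound; exists (2 * M (N k))%N => //=.
by rewrite muln_gt0 vprod_gt0.
Qed.

End divergence.

Theorem mainTheorem3 (R : realType) (m : nat -> nat)
    (hm : bounded_sequence m) (mu : probability (vilenkin m) R)
    (hmu : normalized_haar mu) :
  (exists c : R, forall f : nat -> vilenkin m -> R[i], hardy mu 2^-1 f ->
    (ereal_sup [set ((n%:R * ln n%:R)^-1)%:E *
        \sum_(1 <= k < n.+1)
          poweR (cLnorm mu 2^-1 (fejer (mfourier mu f) k)) 2^-1
      | n in [set n : nat | (2 <= n)%N]]
     <= c%:E * poweR (Hnorm mu 2^-1 f) 2^-1)%E)
  /\
  (forall phi : nat -> R,
    (forall n, (1 <= n)%N -> 1 <= phi n) ->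
    (forall n n', (1 <= n)%N -> (n <= n')%N -> phi n <= phi n') ->
    limn_esup (fun n => (ln n%:R / phi n)%:E) = +oo%E ->
    exists f : nat -> vilenkin m -> R[i], hardy mu 2^-1 f /\
      ereal_sup [set (((n%:R * phi n)^-1)%:E *
          \sum_(1 <= k < n.+1)
            poweR (Hnorm mu 2^-1
              (of_function mu (fejer (mfourier mu f) k))) 2^-1)%E
        | n in [set n : nat | (1 <= n)%N]] = +oo%E).
Proof.
case: hm => m_ge2 [B m_leB]; split; last first.
  by move=> phi phi1 phim phis; exact: (strong_fejer_diverges m_ge2 m_leB).
exists (fejer_constant R B) => f [fm _].
rewrite (martingaleE m_ge2 hmu fm) mfourier_coef //.
by apply: ge_ereal_sup => _ [n n2 <-]; exact: strong_fejer_le.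
Qed.
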